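(* For any graph $G$, the following equalities hold: $$V_{T}(G) = V_{ESG}(G) = V_{J}(G).$$
   Context: All graphs are finite, undirected and simple. A matching is a set of pairwise nonadjacent edges; a vertex is unsaturated (unmatched) by a matching $M$ if it is not an endpoint of an edge of $M$; a maximum matching is a matching of maximum cardinality. A walk in $G$ is a sequence of vertices $v_1v_2\cdots v_k$ with $v_iv_{i+1}\in E(G)$ for all $i$; its length is its number of edges counted with repetition. A path is a walk whose vertices are all different. A walk or path is $M$-alternating if for each pair of consecutive edges exactly one belongs to $M$; it is $mm$-alternating if moreover its first and last edges belong to $M$. Let $M$ be a maximum matching of $G$. An $M$-blossom is an odd cycle of length $2k+1$ in $G$ containing exactly $k$ edges of $M$; its base is the unique vertex of the cycle that is not matched by $M$ to another vertex of the cycle. An $M$-flower consists of an $M$-blossom together with an $M$-stem: an even-length $M$-alternating path (possibly of length zero) connecting the base of the blossom to a vertex unmatched by $M$, such that the base is the only vertex shared by the blossom and the stem. An $M$-posy consists of two distinct (not necessarily disjoint) $M$-blossoms joined by an odd-length $mm$-alternating path (with respect to $M$) whose endpoints are the bases of the two blossoms. An $M$-Tposy is an $M$-posy whose connecting path is internally disjoint from the blossoms (no internal vertex of the path lies on either blossom). An $M$-Jflower consists of an $M$-blossom and an even-length $M$-alternating walk (possibly of length zero) that starts at the base of the blossom and ends at an $M$-unsaturated vertex of $G$. An $M$-Jposy consists of two (not necessarily distinct) $M$-blossoms joined by an odd-length $mm$-alternating walk (with respect to $M$) whose endpoints are the bases of the two blossoms. The vertices of a configuration are the vertices of its blossom(s)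 and of its path or walk. A flower, posy, Tposy, Jflower or Jposy of $G$ means one relative to some maximum matching $M$ of $G$. $V_{T}(G)$ is the set of vertices of $G$ contained in some flower or some Tposy of $G$; $V_{ESG}(G)$ is the set of vertices of $G$ contained in some flower or some posy of $G$; $V_{J}(G)$ is the set of vertices of $G$ contained in some Jflower or some Jposy of $G$. *)

(* Defs.v *)
From mathcomp Require Import all_boot.
From mathcomp Require Import boolp.

Set Implicit Arguments.
Unset Strict Implicit.
Unset Printing Implicit Defensive.

(** A finite simple graph is a symmetric irreflexive relation [e] on a finite
    type [T]; an edge is identified with the set of its two endpoints. *)
Definition edges (T : finType) (e : rel T) : {set {set T}} :=
  [set E : {set T} | [exists x, exists y, e x y && (E == [set x; y])]].

Definition is_matching (T : finType) (e : rel T) (M : {set {set T}}) : bool :=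
  (M \subset edges e) && trivIset M.

Definition maximum_matching (T : finType) (e : rel T) (M : {set {set T}}) : Prop :=
  is_matching e M /\ forall N, is_matching e N -> #|N| <= #|M|.

Definition unsaturated (T : finType) (M : {set {set T}}) (v : T) : bool :=
  v \notin cover M.

(** The walk with vertex sequence [x :: p] is given by its origin [x] and
    the sequence [p] of the next vertices: it is a walk of the graph when
    [path e x p], its length is [size p], its end is [last x p], and it is a
    path in the graph-theoretic sense when moreover [uniq (x :: p)]. *)
Definition walk_edges (T : finType) (x : T) (p : seq T) : seq {set T} :=
  pairmap (fun u v => [set u; v]) x p.

Definition alternating (T : finType) (M : {set {set T}}) (x : T) (p : seq T) : bool :=
  sorted (fun E F => (E \in M) (+) (F \in M)) (walk_edges x p).

(** A walk of length zero is not mm-alternating, since [set0] is not an edge. *)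
Definition mm_alternating (T : finType) (M : {set {set T}}) (x : T) (p : seq T) : bool :=
  [&& alternating M x p,
      head set0 (walk_edges x p) \in M
    & last set0 (walk_edges x p) \in M].

(** A cycle is represented by a cyclic enumeration [c] of its vertices. Rotating
    or reversing [c] gives the same cycle, so cycles have to be compared through
    [cycle_edges]. *)
Definition is_cycle (T : finType) (e : rel T) (c : seq T) : bool :=
  [&& 2 < size c, uniq c & cycle e c].

Definition cycle_edges (T : finType) (c : seq T) : {set {set T}} :=
  [set [set x; next c x] | x in c].

(** The length is [2k+1] with [k] the number of edges of [M] on the cycle. *)
Definition blossom (T : finType) (e : rel T) (M : {set {set T}}) (c : seq T) : bool :=
  is_cycle e c && (size c == (#|cycle_edges c :&: M|).*2.+1).

Definition blossom_base (T : finType) (M : {set {set T}}) (c : seq T) (b : T) : bool :=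
  [set v in c | ~~ [exists w in c, (w != v) && ([set v; w] \in M)]] == [set b].

Definition based_blossom (T : finType) (e : rel T) (M : {set {set T}})
    (c : seq T) (b : T) : bool :=
  blossom e M c && blossom_base M c b.

(** Stems and connecting walks are oriented: they start at the base [b]. *)
Definition stem (T : finType) (e : rel T) (M : {set {set T}})
    (b : T) (p : seq T) : bool :=
  [&& path e b p, uniq (b :: p), ~~ odd (size p), alternating M b p
    & unsaturated M (last b p)].

Definition flower (T : finType) (e : rel T) (M : {set {set T}})
    (c : seq T) (b : T) (p : seq T) : bool :=
  [&& based_blossom e M c b, stem e M b p
    & [forall v, (v \in c) && (v \in b :: p) ==> (v == b)]].

Definition jflower (T : finType) (e : rel T) (M : {set {set T}})
    (c : seq T) (b : T) (p : seq T) : bool :=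
  [&& based_blossom e M c b, path e b p, ~~ odd (size p), alternating M b p
    & unsaturated M (last b p)].

Definition jposy (T : finType) (e : rel T) (M : {set {set T}})
    (c1 c2 : seq T) (b : T) (p : seq T) : bool :=
  [&& based_blossom e M c1 b, based_blossom e M c2 (last b p),
      path e b p, odd (size p) & mm_alternating M b p].

Definition posy (T : finType) (e : rel T) (M : {set {set T}})
    (c1 c2 : seq T) (b : T) (p : seq T) : bool :=
  [&& based_blossom e M c1 b, based_blossom e M c2 (last b p),
      cycle_edges c1 != cycle_edges c2,
      path e b p, uniq (b :: p), odd (size p) & mm_alternating M b p].

Definition tposy (T : finType) (e : rel T) (M : {set {set T}})
    (c1 c2 : seq T) (b : T) (p : seq T) : bool :=
  posy e M c1 c2 b p &&
  [forall v in b :: p, (v != b) && (v != last b p) ==>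
     (v \notin c1) && (v \notin c2)].

Definition in_flower (T : finType) (e : rel T) (v : T) : Prop :=
  exists M c b p,
    [/\ maximum_matching e M, flower e M c b p & v \in c ++ b :: p].

Definition in_jflower (T : finType) (e : rel T) (v : T) : Prop :=
  exists M c b p,
    [/\ maximum_matching e M, jflower e M c b p & v \in c ++ b :: p].

Definition in_posy (T : finType) (e : rel T) (v : T) : Prop :=
  exists M c1 c2 b p,
    [/\ maximum_matching e M, posy e M c1 c2 b p & v \in c1 ++ c2 ++ b :: p].

Definition in_tposy (T : finType) (e : rel T) (v : T) : Prop :=
  exists M c1 c2 b p,
    [/\ maximum_matching e M, tposy e M c1 c2 b p & v \in c1 ++ c2 ++ b :: p].

Definition in_jposy (T : finType) (e : rel T) (v : T) : Prop :=
  exists M c1 c2 b p,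
    [/\ maximum_matching e M, jposy e M c1 c2 b p & v \in c1 ++ c2 ++ b :: p].

Definition V_T (T : finType) (e : rel T) : {set T} :=
  [set v | `[< in_flower e v \/ in_tposy e v >]].

Definition V_ESG (T : finType) (e : rel T) : {set T} :=
  [set v | `[< in_flower e v \/ in_posy e v >]].

Definition V_J (T : finType) (e : rel T) : {set T} :=
  [set v | `[< in_jflower e v \/ in_jposy e v >]].

(* Main.v *)
Require Import Defs.
From mathcomp Require Import all_boot.
From mathcomp Require Import boolp.

(** Only the inclusion of V_J in V_T is not immediate.  Let [m] be the mate
    function of a maximum matching.  A vertex entered through its matching
    edge is a node, and the alternating walks are the walks of the digraph on
    nodes with an arc from [x] to [y] when [x] is adjacent to [m y]; exchanging
    [x] and [m x] reverses all the arcs.  A saturated vertex [v] of a Jflower or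
    Jposy can be joined in this digraph to [m v] and back.  Hence, starting from
    the matching edge of [v] seen as a degenerate alternating cycle, we get an
    alternating cycle Z through [v] with an attachment on each of its two sides
    (the vertices left by a non-matching edge when Z is run through in one
    direction or in the other): an ear, that is a path returning to the same
    side of Z, or a lollipop, that is a stem ending in a blossom or in an
    unsaturated vertex.  When both attachments are ears, or when they are
    disjoint, a flower or a Tposy through [v] is found in Z and the
    attachments, possibly after exchanging the matching along Z.  Otherwise the
    first vertex at which one attachment meets the lollipop on the other side
    gives either a flower or a Tposy through [v], or a new alternating cycle
    through [v] whose attachments have shorter stems. *)

Set Implicit Arguments.
Unset Strict Implicit.
Unset Printing Implicit Defensive.

(** * Regular sets of nodes *)

Section Regular.
Variables (T : finType) (m : T -> T).
Hypothesis mK : involutive m.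
Implicit Types (x y : T) (p q s : seq T).

(* The closures of [p] and [q] under [m] are disjoint. *)
Definition apart p q := all (fun x => (x \notin q) && (m x \notin q)) p.

(* No two nodes of [p] lie on the same matching edge; this also forces the
   vertices of [p] to be saturated, as [m] fixes the unsaturated ones. *)
Definition regular p := uniq p && all (fun x => m x \notin p) p.

Lemma mate_eq x y : (m x == y) = (x == m y).
Proof. by apply/eqP/eqP => [<-|->]; rewrite mK. Qed.

Lemma mem_map_mate x p : (x \in map m p) = (m x \in p).
Proof. by rewrite -{1}[x]mK mem_map //; apply: inv_inj. Qed.

Lemma apartP p q : reflect (forall x, x \in p -> x \notin q /\ m x \notin q) (apart p q).
Proof.
apply: (iffP allP) => h x /h; first by move/andP.
by case=> -> ->.
Qed.

Lemma apartC p q : apart p q = apart q p.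
Proof.
apply/apartP/apartP => h x xp; split; apply/negP => xq.
- by have [] := h x xq; rewrite xp.
- by have [] := h _ xq; rewrite mK xp.
- by have [] := h x xq; rewrite xp.
- by have [] := h _ xq; rewrite mK xp.
Qed.

Lemma apart_catl p q s : apart (p ++ q) s = apart p s && apart q s.
Proof. exact: all_cat. Qed.

Lemma apart_catr p q s : apart s (p ++ q) = apart s p && apart s q.
Proof. by rewrite apartC apart_catl !(apartC s). Qed.

Lemma apart_nil p : apart [::] p. Proof. by []. Qed.

Lemma apart_nilr p : apart p [::]. Proof. by rewrite apartC. Qed.

Lemma apart_rconsr x p q : apart q (rcons p x) = apart q p && apart q [:: x].
Proof. by rewrite -cats1 apart_catr. Qed.

Lemma apart_rev p q : apart (rev p) q = apart p q.
Proof. exact: all_rev. Qed.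

Lemma apart_revr p q : apart q (rev p) = apart q p.
Proof. by rewrite apartC apart_rev apartC. Qed.

Lemma apart_map p q : apart (map m p) q = apart p q.
Proof.
by rewrite /apart all_map; apply: eq_all => x /=; rewrite mK andbC.
Qed.

Lemma apart_mapr p q : apart q (map m p) = apart q p.
Proof. by rewrite apartC apart_map apartC. Qed.

Lemma apart_m1 x q : apart [:: m x] q = apart [:: x] q.
Proof. by rewrite -(apart_map [:: x]). Qed.

Lemma apart_m1r x q : apart q [:: m x] = apart q [:: x].
Proof. by rewrite apartC apart_m1 apartC. Qed.

Lemma regular_nil : regular [::]. Proof. by []. Qed.

Lemma regular1 x : regular [:: x] = (m x != x).
Proof. by rewrite /regular /= inE andbT. Qed.

Lemma regular_cat p q : regular (p ++ q) = [&& regular p, regular q & apart p q].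
Proof.
rewrite /regular cat_uniq all_cat; apply/andP/idP.
- move=> [/and3P[up hpq uq] /andP[ap aq]].
  have hd : apart p q.
    apply/apartP => x xp; split.
      by apply/negP => xq; move/hasPn: hpq => /(_ x xq); rewrite xp.
    by move/allP: ap => /(_ x xp); rewrite mem_cat negb_or => /andP[].
  rewrite up uq hd !andbT; apply/andP; split; apply/allP => x xp.
    by move/allP: ap => /(_ x xp); rewrite mem_cat negb_or => /andP[].
  by move/allP: aq => /(_ x xp); rewrite mem_cat negb_or => /andP[].
- move=> /and3P[/andP[up ap] /andP[uq aq] d]; rewrite up uq.
  have d' := d; rewrite apartC in d'.
  split.
    rewrite andbT; apply/hasPn => x xq; by have [] := apartP _ _ d' x xq.
  apply/andP; split; apply/allP => x xp; rewrite mem_cat negb_or.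
    by rewrite (allP ap) //; have [] := apartP _ _ d x xp.
  by rewrite (allP aq) //= andbT; have [] := apartP _ _ d' x xp.
Qed.

Lemma regular_cons x p : regular (x :: p) = [&& m x != x, regular p & apart [:: x] p].
Proof. by rewrite -cat1s regular_cat regular1. Qed.

Lemma regular_rcons x p : regular (rcons p x) = [&& regular p, m x != x & apart p [:: x]].
Proof. by rewrite -cats1 regular_cat regular1. Qed.

Lemma regular_rev p : regular (rev p) = regular p.
Proof.
by rewrite /regular rev_uniq all_rev; congr andb; apply: eq_all => x; rewrite mem_rev.
Qed.

Lemma regular_map p : regular (map m p) = regular p.
Proof.
rewrite /regular map_inj_uniq ?all_map; last exact: inv_inj.
by congr andb; apply: eq_all => x /=; rewrite mem_map_mate mK.
Qed.

Lemma regular_uniq p : regular p -> uniq p. Proof. by case/andP. Qed.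

Lemma regular_fix p x : regular p -> x \in p -> m x != x.
Proof.
by move=> /andP[_ /allP h] xp; apply/eqP => e; have := h x xp; rewrite e xp.
Qed.

Lemma apart_mem p q x : apart p q -> x \in p -> x \in q = false.
Proof. by move=> /apartP h /h[] /negbTE. Qed.

Lemma apart_memm p q x : apart p q -> m x \in p -> x \in q = false.
Proof. by move=> /apartP h /h[_]; rewrite mK => /negbTE. Qed.

Lemma apart_sub p p' q : {subset p' <= p} -> apart p q -> apart p' q.
Proof. by move=> sp /allP h; apply/allP => x /sp /h. Qed.

Lemma apart1 x q : apart [:: x] q = (x \notin q) && (m x \notin q).
Proof. by rewrite /apart /= andbT. Qed.

Lemma eq_apartl p p' q : p =i p' -> apart p q = apart p' q.
Proof.
by move=> h; apply/allP/allP => d x xp; apply: d; rewrite ?h // -h.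
Qed.

End Regular.

#[global] Arguments apart : simpl never.
#[global] Arguments regular : simpl never.

(** * The digraph of nodes and its duality *)

Section Digraph.
Variables (T : finType) (e : rel T) (m : T -> T).
Hypotheses (e_sym : symmetric e) (e_irr : irreflexive e) (mK : involutive m).
Implicit Types (x y : T) (p q s : seq T).

(* From [x], entered through its matching edge, one may follow the edge from [x]
   to [m y] and then the matching edge to [y]. *)
Definition step : rel T := fun x y => e x (m y).

Lemma step_dual x y : step (m y) (m x) = step x y.
Proof. by rewrite /step mK e_sym. Qed.

Lemma path_dual x p y :
  path step x (rcons p y) -> path step (m y) (rcons (rev (map m p)) (m x)).
Proof.
elim: p x => [|z p ih] x /=; first by rewrite !andbT step_dual.
move=> /andP[xz /ih h]; rewrite rev_cons rcons_path last_rcons step_dual xz.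
by rewrite h.
Qed.

Lemma connect_dual x y : connect step x y -> connect step (m y) (m x).
Proof.
case/connectP => p; elim/last_ind: p => [|p z _] hp ->; first exact: connect0.
rewrite last_rcons; apply/connectP; exists (rcons (rev (map m p)) (m x)).
  exact: path_dual.
by rewrite last_rcons.
Qed.

Lemma cycle_dual p : cycle step p -> cycle step (rev (map m p)).
Proof.
case: p => // x p; rewrite /= => /path_dual h.
by rewrite rev_cons -rot1_cons rot_cycle.
Qed.

Lemma eq_in_path_step m' x p : {in p, m =1 m'} ->
  path step x p = path (fun y z => e y (m' z)) x p.
Proof.
elim: p x => //= y p ih x h; rewrite ih => [|z zp]; last by rewrite h // inE zp orbT.
by rewrite /step h ?mem_head.
Qed.

End Digraph.

(** * Exchange along an alternating cycle *)

Section Prev.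
Variables (T : eqType).
Implicit Types (x y : T) (p q s : seq T).

Lemma prev_adjacent p x y q : uniq (p ++ x :: y :: q) -> prev (p ++ x :: y :: q) y = x.
Proof.
move=> u; have := cycle_prev u; rewrite -(rot_cycle (size p)) rot_size_cat /=.
by case/andP => /eqP.
Qed.

Lemma prev_first x p : uniq (x :: p) -> prev (x :: p) x = last x p.
Proof. by move=> /cycle_prev; rewrite (cycle_path x) /= => /andP[/eqP]. Qed.

Lemma next_adjacent p x y q : uniq (p ++ x :: y :: q) -> next (p ++ x :: y :: q) x = y.
Proof.
move=> u; have := cycle_next u; rewrite -(rot_cycle (size p)) rot_size_cat /=.
by case/andP => /eqP.
Qed.

End Prev.

Section Switch.
Variables (T : finType) (e : rel T).
Hypotheses (e_sym : symmetric e) (e_irr : irreflexive e).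
Implicit Types (m : T -> T) (x y v w : T) (p q s c Z L R W : seq T).

(* Fixed points are the unsaturated vertices. *)
Definition mating m := involutive m /\ forall x, m x = x \/ e x (m x).

(* The alternating cycle represented by [Z] visits [m x] and then [x] for each
   node [x] of [Z]. *)
Definition switch m Z x :=
  if x \in Z then m (next Z x)
  else if m x \in Z then prev Z (m x) else m x.

Lemma switch_off m Z x : x \notin Z -> m x \notin Z -> switch m Z x = m x.
Proof. by rewrite /switch => /negbTE -> /negbTE ->. Qed.

Lemma mem_switch m Z x : involutive m -> regular m Z ->
  (switch m Z x \in Z) = (m x \in Z).
Proof.
move=> mK /andP[uZ /allP aZ]; rewrite /switch.
case: ifP => xZ.
  by rewrite (negbTE (aZ _ xZ)); apply/negbTE/aZ; rewrite mem_next.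
by case: ifP => mxZ; rewrite ?mem_prev.
Qed.

Lemma switch_inv m Z : involutive m -> regular m Z -> involutive (switch m Z).
Proof.
move=> mK rZ x; have /andP[uZ /allP aZ] := rZ.
have [xZ|xZ] := boolP (x \in Z).
  have nx : next Z x \in Z by rewrite mem_next.
  have -> : switch m Z x = m (next Z x) by rewrite /switch xZ.
  by rewrite /switch (negbTE (aZ _ nx)) mK nx prev_next.
have [mxZ|mxZ] := boolP (m x \in Z).
  have px : prev Z (m x) \in Z by rewrite mem_prev.
  have -> : switch m Z x = prev Z (m x) by rewrite /switch (negbTE xZ) mxZ.
  by rewrite /switch px next_prev // mK.
by rewrite !switch_off ?mK.
Qed.

Lemma switch_fix m Z x : involutive m -> regular m Z ->
  (switch m Z x == x) = (m x == x).
Proof.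
move=> mK rZ; have /andP[uZ /allP aZ] := rZ; rewrite /switch.
case: ifP => xZ.
  transitivity false; last first.
    by apply/esym/eqP => mx; have := aZ x xZ; rewrite mx xZ.
  have nx : next Z x \in Z by rewrite mem_next.
  by apply/eqP => h; have := aZ _ nx; rewrite h xZ.
case: ifP => mxZ //.
transitivity false; last first.
  by apply/esym/eqP => h; rewrite h xZ in mxZ.
have nx : prev Z (m x) \in Z by rewrite mem_prev.
by apply/eqP => h; rewrite h xZ in nx.
Qed.

(** Every vertex met by the cycle gets a new mate along a nonmatching edge, so adjacency of mates is
    asked only off the cycle. Virtual matching edges on the cycle are thus allowed, and the exchange
    removes them. *)
Lemma switch_mating m Z : involutive m -> regular m Z -> cycle (step e m) Z ->
  (forall x, x \notin Z -> m x \notin Z -> m x = x \/ e x (m x)) ->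
  mating (switch m Z).
Proof.
move=> mK rZ cZ mE; split; first exact: switch_inv.
move=> x; have [xZ|xZ] := boolP (x \in Z).
  by right; rewrite /switch xZ; have := next_cycle cZ xZ.
have [mxZ|mxZ] := boolP (m x \in Z); last by rewrite switch_off //; exact: mE.
right; rewrite /switch (negbTE xZ) mxZ.
by have := prev_cycle cZ mxZ; rewrite /step mK e_sym.
Qed.

(** The exchange keeps the nodes but reverses the direction: the arc from [next Z x] to [x] is now
    given by the old matching edge of [next Z x]. *)
Lemma switch_cycle m Z : mating m -> regular m Z -> cycle (step e m) Z ->
  cycle (step e (switch m Z)) (rev Z).
Proof.
move=> [mK mE] rZ cZ; rewrite rev_cycle.
apply: cycle_from_next => [|x xZ]; first exact: regular_uniq rZ.
rewrite /step /switch xZ.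
have nx : next Z x \in Z by rewrite mem_next.
by have [h|//] := mE (next Z x); have := regular_fix rZ nx; rewrite h eqxx.
Qed.

(* [m x] and [w] split the cycle into two arcs; if [v] is not on the one which
   is alternating for [m], it is on the other, which is so after the exchange. *)
Lemma arc_through m Z x w v : mating m -> regular m Z -> cycle (step e m) Z ->
  m x \in Z -> w \in Z -> (v \in Z) || (m v \in Z) ->
  exists m' L R,
  [/\ mating m' /\ (forall y, (m' y == y) = (m y == y)),
      regular m' (L ++ R) /\ cycle (step e m') (L ++ R),
      L ++ R =i Z /\ (forall y, (m' y \in Z) = (m y \in Z)),
      (forall y, y \notin Z -> m y \notin Z -> m' y = m y)
    & [/\ exists L', L = m' x :: L', last x L = w & (v \in L) || (m' v \in L)]].
Proof.
move=> mm rZ cZ xZ wZ vZ.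
have [i Z1 eZ] := rot_to xZ.
have eqZ y : (y \in m x :: Z1) = (y \in Z) by rewrite -eZ mem_rot.
have uZ := regular_uniq rZ.
have rZ1 : regular m (m x :: Z1).
  have /andP[_ /allP aZ] := rZ.
  rewrite /regular -eZ rot_uniq uZ; apply/allP => y; rewrite mem_rot => yZ.
  by rewrite mem_rot aZ.
have cZ1 : cycle (step e m) (m x :: Z1) by rewrite -eZ rot_cycle.
have wZ1 : w \in m x :: Z1 by rewrite eqZ.
have [L [R eLR]] : exists L R, m x :: Z1 = rcons L w ++ R.
  by case/path.splitPr: wZ1 => L R; exists L, R; rewrite cat_rcons.
case vL : ((v \in rcons L w) || (m v \in rcons L w)).
  exists m, (rcons L w), R; rewrite -eLR; split=> //; split=> //.
    case: (L) eLR => [|y L'] /= [->]; first by exists [::].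
    by exists (rcons L' w).
  by rewrite last_rcons.
have {vL} vR : (v \in w :: R) || (m v \in R).
  move: vZ vL; rewrite -!eqZ eLR !mem_cat !mem_rcons !inE.
  by case: (v == w); case: (v \in L); case: (m v == w); case: (m v \in L); case: (v \in R).
have mK := mm.1.
(* Here [v] is on the other arc. After the exchange, the reversed cycle starts at the predecessor of
   [m x], which is the new mate of [x], and runs through that arc until [w]. *)
pose Z2 := m x :: Z1; exists (switch m Z2), (rev (w :: R)), (rev L).
have eZ2 : rev (w :: R) ++ rev L = rev Z2.
  by rewrite -rev_cat /Z2 eLR -cats1 -catA.
have hsw y : (switch m Z2 y \in Z2) = (m y \in Z2) by rewrite mem_switch.
split=> //.
- split=> [|y]; last by rewrite switch_fix.
  by apply: switch_mating => // y _ _; case: mm.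
- rewrite eZ2; split; last exact: switch_cycle.
  rewrite regular_rev /regular (regular_uniq rZ1); apply/allP => y yZ.
  by rewrite hsw (allP (proj2 (andP rZ1))).
- split=> y; first by rewrite eZ2 mem_rev eqZ.
  by rewrite -!eqZ hsw.
- by move=> y; rewrite -!eqZ => h1 h2; rewrite switch_off.
have xnZ : x \notin Z2.
  by have := allP (proj2 (andP rZ1)) (m x); rewrite mem_head mK; apply.
have psw y : y \notin Z2 -> m y \in Z2 -> switch m Z2 y = prev Z2 (m y).
  by rewrite /switch => /negbTE -> ->.
have hl : last w R = last (m x) Z1.
  by rewrite -[RHS](last_cons x) eLR last_cat last_rcons.
split.
- rewrite psw ?mem_head // /Z2 prev_first //; last exact: regular_uniq rZ1.
  rewrite -hl; case/lastP: (R) => [|R' z]; first by exists [::].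
  by rewrite last_rcons -rcons_cons rev_rcons; eexists.
- by rewrite rev_cons last_rcons.
rewrite !mem_rev.
case/orP: vR => [->//|mvR].
have vnZ : v \notin Z2.
  have := allP (proj2 (andP rZ1)) (m v); rewrite mK; apply.
  by rewrite eLR mem_cat mvR orbT.
have mvZ : m v \in Z2 by rewrite /Z2 eLR mem_cat mvR orbT.
rewrite psw //; apply/orP; right.
have uZ2 := regular_uniq rZ1.
case/path.splitPr: mvR eLR uZ2 => R1 R2 eLR uZ2.
have -> : prev Z2 (m v) = last w R1.
  have eq : Z2 = (L ++ belast w R1) ++ last w R1 :: m v :: R2.
    by rewrite /Z2 eLR cat_rcons -cat_cons lastI cat_rcons catA.
  by move: uZ2; rewrite -/Z2 eq => /prev_adjacent.
by rewrite -cat_cons mem_cat mem_last.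
Qed.

End Switch.

(** * Matchings and mate functions *)

Lemma leq_balance a b c d : a + c = b + d -> c <= d -> b <= a.
Proof. by move=> E le; rewrite -(leq_add2r d) -E leq_add2l. Qed.

Section Matching.
Variables (T : finType) (e : rel T).
Hypotheses (e_sym : symmetric e) (e_irr : irreflexive e).
Implicit Types (m : T -> T) (x y v w : T) (M N : {set {set T}}).

Definition fixed_count m := #|[pred x | m x == x]|.

(** Maximality is stated through the unsaturated vertices because an exchange along an alternating
    cycle leaves them unchanged. *)
Definition max_mating m := mating e m /\
  forall m', mating e m' -> fixed_count m <= fixed_count m'.

Definition represents M m := mating e m /\
  forall x y, ([set x; y] \in M) = (x != y) && (m x == y).

Lemma matching_edge M E : is_matching e M -> E \in M ->
  exists x y, e x y /\ E = [set x; y].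
Proof.
move=> /andP[/subsetP s _] /s; rewrite inE => /existsP[x /existsP[y /andP[exy /eqP ->]]].
by exists x, y.
Qed.

Lemma edge_neq x y : e x y -> x != y.
Proof. by apply: contraTneq => ->; rewrite e_irr. Qed.

Lemma matching_rel M x y : is_matching e M -> [set x; y] \in M -> e x y.
Proof.
move=> hM /(matching_edge hM)[a [b [ab E]]].
have xy : x != y.
  have := cards2 x y; rewrite E cards2 (edge_neq ab).
  by case: (x != y).
have xa : x \in [set a; b] by rewrite -E set21.
have ya : y \in [set a; b] by rewrite -E set22.
move: xa ya xy; rewrite !inE.
by case/orP=> /eqP -> /orP[] /eqP -> //; rewrite ?eqxx // e_sym.
Qed.

Lemma matching_mate M x y z : is_matching e M ->
  [set x; y] \in M -> [set x; z] \in M -> x != y -> x != z -> y = z.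
Proof.
move=> /andP[_ /trivIsetP tM] hy hz xy xz.
have [E|E] := eqVneq [set x; y] [set x; z].
  have : y \in [set x; z] by rewrite -E set22.
  by rewrite !inE eq_sym (negbTE xy) => /eqP.
have := tM _ _ hy hz E; rewrite disjoint_subset => /subsetP/(_ x).
by rewrite set21 => /(_ isT); rewrite !inE eqxx.
Qed.

Lemma represented M : is_matching e M -> exists m, represents M m.
Proof.
move=> hM.
pose m x := odflt x [pick y | (x != y) && ([set x; y] \in M)].
have mE x y : ([set x; y] \in M) = (x != y) && (m x == y).
  rewrite /m; case: pickP => [z /andP[xz zM]|h] /=.
    apply/idP/andP => [yM|[xy /eqP <- //]].
    have xy := edge_neq (matching_rel hM yM).
    by split=> //; apply/eqP; apply: (matching_mate hM zM yM xz xy).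
  apply/idP/andP => [yM|[xy /eqP xy']]; last by rewrite xy' eqxx in xy.
  by have := h y; rewrite yM (edge_neq (matching_rel hM yM)).
exists m; split=> //; split=> x.
  have [xx|xx] := eqVneq x (m x); first by rewrite -!xx.
  have : [set x; m x] \in M by rewrite mE xx eqxx.
  by rewrite setUC mE => /andP[_ /eqP].
have [xx|xx] := eqVneq x (m x); [by left | right].
have : [set x; m x] \in M by rewrite mE xx eqxx.
exact: matching_rel.
Qed.

Lemma represented_unsaturated M m x : is_matching e M -> represents M m ->
  unsaturated M x = (m x == x).
Proof.
move=> hM [[mK mE] mM]; rewrite /unsaturated /cover.
apply/idP/eqP => [/bigcupP h|mx].
  apply/eqP/negPn/negP => xm; apply: h; exists [set x; m x]; last exact: set21.
  by rewrite mM eq_sym xm eqxx.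
apply/bigcupP => -[E EM xE]; have [a [b [ab EE]]] := matching_edge hM EM.
move: EM xE; rewrite EE mM !inE => /andP[nab /eqP mab] /orP[] /eqP xE.
  by rewrite -mab -xE mx eqxx in nab.
by rewrite -(mK a) mab -xE mx eqxx in nab.
Qed.

Lemma card_matching M m : is_matching e M -> represents M m ->
  #|M|.*2 + fixed_count m = #|T|.
Proof.
move=> hM rM; have /andP[_ tM] := hM.
have <- : #|cover M| = #|M|.*2.
  rewrite -(eqP tM) -muln2 -sum_nat_const; apply: eq_bigr => E EM.
  have [a [b [/edge_neq ab ->]]] := matching_edge hM EM.
  by rewrite cards2 ab.
rewrite -(cardC (mem (cover M))); congr addn; apply: eq_card => x.
by rewrite !inE -(represented_unsaturated _ hM rM).
Qed.

Definition mating_set m : {set {set T}} := [set [set x; m x] | x in [pred x | m x != x]].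

Lemma mating_setP m : mating e m ->
  is_matching e (mating_set m) /\ represents (mating_set m) m.
Proof.
move=> mm; have [mK mE] := mm.
have rep x y : ([set x; y] \in mating_set m) = (x != y) && (m x == y).
  apply/imsetP/andP => [[z /= zz E]|[xy /eqP xy']]; last first.
    by exists x; rewrite ?inE /= xy' // eq_sym.
  rewrite inE in zz.
  have hx : x \in [set z; m z] by rewrite -E set21.
  have hy : y \in [set z; m z] by rewrite -E set22.
  have hz : z \in [set x; y] by rewrite E set21.
  have hz' : m z \in [set x; y] by rewrite E set22.
  move: hx hy hz hz'; rewrite !inE.
  case/orP=> /eqP -> /orP[] /eqP ->; rewrite ?mK ?eqxx ?orbb //.
  - by move=> _ /eqP h; rewrite h eqxx in zz.
  - by rewrite eq_sym.
  - by rewrite eq_sym (negbTE zz).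
split; last by split.
apply/andP; split.
  apply/subsetP => E /imsetP[x xx ->]; rewrite inE in xx; rewrite inE.
  apply/existsP; exists x; apply/existsP; exists (m x); rewrite eqxx andbT.
  by have [h|//] := mE x; rewrite h eqxx in xx.
apply/trivIsetP => E F /imsetP[x xx ->] /imsetP[y yy ->].
apply: contraR => /pred0Pn[z /= /andP[]]; rewrite !inE.
by case/orP=> /eqP -> /orP[] /eqP h; apply/eqP; rewrite ?h //;
   [rewrite mK setUC | rewrite -h mK setUC | rewrite (can_inj mK h)].
Qed.

Lemma max_mating_set m : max_mating m -> maximum_matching e (mating_set m).
Proof.
move=> [mm hm]; have [hM rM] := mating_setP mm; split=> // N hN.
have [m' rN] := represented hN.
have := hm _ rN.1; have := card_matching hM rM; rewrite -(card_matching hN rN).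
by move=> E le; rewrite -leq_double; apply: leq_balance le.
Qed.

Lemma max_represents M m : maximum_matching e M -> represents M m -> max_mating m.
Proof.
move=> [hM mM] rM; split; first exact: rM.1.
move=> m' mm'; have [hN rN] := mating_setP mm'.
have := mM _ hN; have := card_matching hM rM; rewrite -(card_matching hN rN).
by move=> E; rewrite -leq_double; apply: leq_balance; rewrite addnC -E addnC.
Qed.

End Matching.

(** * Absence of augmenting paths *)

Section Augment.
Variables (T : finType) (e : rel T).
Hypotheses (e_sym : symmetric e) (e_irr : irreflexive e).
Implicit Types (m : T -> T) (u v : T) (Q : seq T).

Lemma no_augmenting m u v Q : max_mating e m -> m u = u -> m v = v -> u != v ->
  path (step e m) u Q -> regular m Q -> e (last u Q) v -> False.
Proof.
move=> [[mK mE] mM] mu mv uv pQ rQ eQv.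
(* With [u] and [v] made mates of each other, the augmenting path becomes an
   alternating cycle for [m1], and the exchange removes the virtual edge [uv]. *)
pose m1 x := if x == u then v else if x == v then u else m x.
have uQ x : x \in Q -> x != u /\ x != v.
  move=> xQ; have := regular_fix rQ xQ.
  by split; apply: contraNneq H => ->; rewrite ?mu ?mv.
have m1Q x : x \in Q -> m1 x = m x.
  by move=> /uQ[xu xv]; rewrite /m1 (negbTE xu) (negbTE xv).
have m1K : involutive m1.
  move=> x; rewrite /m1; have [->|xu] := eqVneq x u.
    by rewrite eq_sym (negbTE uv) eqxx.
  have [->|xv] := eqVneq x v; first by rewrite eqxx.
  by rewrite !(mate_eq mK) mu mv (negbTE xu) (negbTE xv) mK.
have rZ : regular m1 (u :: Q).
  rewrite (regular_cons m1K); apply/and3P; split.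
  - by rewrite /m1 eqxx eq_sym.
  - rewrite /regular (regular_uniq rQ); apply/allP => x xQ; rewrite m1Q //.
    by have /andP[_ /allP] := rQ; apply.
  - rewrite apart1 /m1 eqxx; apply/andP; split; apply/negP => /uQ; by case; rewrite eqxx.
have cZ : cycle (step e m1) (u :: Q).
  have m1u : m1 u = v by rewrite /m1 eqxx.
  rewrite /= rcons_path {2}/step m1u eQv andbT.
  by rewrite (eq_in_path_step _ _ m1Q).
have mm' : mating e (switch m1 (u :: Q)).
  apply: switch_mating => // x; rewrite /m1.
  have [->|_] := eqVneq x u; first by rewrite mem_head.
  have [->|_] := eqVneq x v; first by rewrite mem_head.
  by move=> _ _; exact: mE.
have := mM _ mm'; rewrite leqNgt => /negP; apply; apply: proper_card.
have fixE x : (switch m1 (u :: Q) x == x) = (m1 x == x) by rewrite switch_fix.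
apply/properP; split.
  apply/subsetP => x; rewrite !inE fixE /m1.
  have [->|_] := eqVneq x u; first by rewrite eq_sym (negbTE uv).
  by have [->|_] := eqVneq x v; first by rewrite (negbTE uv).
by exists u; rewrite !inE ?mu // fixE /m1 eqxx eq_sym.
Qed.

End Augment.

(** * Flowers and Tposies from walks of nodes *)

Section Expand.
Variables (T : finType) (e : rel T) (m : T -> T) (M : {set {set T}}).
Hypotheses (e_sym : symmetric e) (e_irr : irreflexive e) (rM : represents e M m).
Implicit Types (x y b n : T) (p q c : seq T).

Let mK : involutive m := rM.1.1.

(** Turns a walk of nodes into a walk of the graph: an arc to [x] becomes a nonmatching edge to
    [m x] followed by the matching edge to [x]. *)
Definition expand p := flatten [seq [:: m x; x] | x <- p].

Lemma expand_cons x p : expand (x :: p) = m x :: x :: expand p.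
Proof. by []. Qed.

Lemma expand_cat p q : expand (p ++ q) = expand p ++ expand q.
Proof. by rewrite /expand map_cat flatten_cat. Qed.

Lemma mem_expand x p : (x \in expand p) = (x \in p) || (m x \in p).
Proof.
elim: p => //= y p ih; rewrite expand_cons !inE ih [m x == y](mate_eq mK).
by case: (x == y); case: (x == m y); case: (x \in p).
Qed.

Lemma size_expand p : size (expand p) = (size p).*2.
Proof. by elim: p => //= x p ->. Qed.

Lemma last_expand n p : last n (expand p) = last n p.
Proof. by elim: p n => //=. Qed.

Lemma expand_uniq p : regular m p -> uniq (expand p).
Proof.
elim: p => //= x p ih; rewrite (regular_cons mK) => /and3P[mx rp]; rewrite apart1 => /andP[xp mxp].
by rewrite inE (negbTE mx) /= !mem_expand mK negb_or (negbTE xp) (negbTE mxp) ih.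
Qed.

Lemma edge_mate x : m x != x -> e x (m x).
Proof. by have [_ /(_ x)] := rM.1; case=> // ->; rewrite eqxx. Qed.

Lemma expand_path n p : regular m p -> path (step e m) n p -> path e n (expand p).
Proof.
elim: p n => //= x p ih n; rewrite (regular_cons mK) => /and3P[mx rp _] /andP[h1 h2].
by rewrite [e n _]h1 e_sym edge_mate //= ih.
Qed.

(** A preceding matching edge [E] makes the induction uniform. The edge from [n] to [m x] could be
    in the matching only if [n = x], which uniqueness excludes. *)
Lemma expand_alternating E n p : E \in M -> uniq (n :: p) -> regular m p ->
  path (fun E F => (E \in M) (+) (F \in M)) E (walk_edges n (expand p)) /\
  last E (walk_edges n (expand p)) \in M.
Proof.
have [_ hM] := rM.
elim: p E n => //= x p ih E n EM; rewrite in_cons negb_or (regular_cons mK).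
move=> /andP[/andP[nx np] up] /and3P[mx rp _].
have h2 : [set m x; x] \in M by rewrite hM mx mK eqxx.
have -> : [set n; m x] \in M = false.
  by rewrite hM (inj_eq (can_inj mK)) (negbTE nx) andbF.
by rewrite EM h2 /=; apply: ih.
Qed.

(** The base [b] may be unsaturated, so it is kept out of the regular sequence and is only required
    to be apart from it. The last edge closes an odd cycle at [b]. *)
Definition blossom_walk b c :=
  [&& path (step e m) b c, e (last b c) b, regular m c & apart m [:: b] c].

Lemma expand_blossom b c : blossom_walk b c -> based_blossom e M (b :: expand c) b.
Proof.
have [_ hM] := rM.
move=> /and4P[pc ec rc]; rewrite apart1 => /andP[bc mbc].
set C := b :: expand c.
have uC : uniq C by rewrite /= mem_expand negb_or bc mbc expand_uniq.
have mbC : m b != b -> m b \notin C.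
  by rewrite inE negb_or mem_expand mK negb_or => ->; rewrite mbc.
have inC x : (x \in C) = [|| x == b, x \in c | m x \in c] by rewrite inE mem_expand.
have sM x : x \in c -> [set x; m x] \in M.
  by move=> xc; rewrite hM eq_sym (regular_fix rc xc) eqxx.
apply/andP; split; last first.
  apply/eqP/setP => v; rewrite in_set in_set1 inC.
  have [->|vb] := eqVneq v b.
    apply/existsP => -[w /and3P[wC wb]]; rewrite hM => /andP[_ /eqP mbw].
    by rewrite -mbw in wC wb; rewrite (negbTE (mbC wb)) in wC.
  apply/negP => /andP[vC /existsP]; apply.
  have vc : (v \in c) || (m v \in c) by move: vC.
  have mvv : m v != v.
    by case/orP: (vc) => /(regular_fix rc) //; rewrite mK eq_sym.
  exists (m v); rewrite hM [v == m v]eq_sym mvv eqxx inC mK !andbT.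
  by rewrite [(_ \in c) || _]orbC vc orbT.
have c0 : c != [::] by apply: contraTneq ec => ->; rewrite /= e_irr.
apply/andP; split.
  apply/and3P; split=> //.
    by rewrite /= size_expand; case: (c) c0.
  by rewrite /= rcons_path expand_path //= last_expand.
rewrite /= size_expand eqSS; apply/eqP; congr double.
have -> : cycle_edges C :&: M = [set [set x; m x] | x in c].
  apply/setP => E; rewrite inE; apply/andP/imsetP.
    move=> [/imsetP[y yC ->]]; rewrite hM => /andP[yn /eqP my].
    move: yC; rewrite inC => /or3P[/eqP yb|yc|yc].
    - have : next C y \in C by rewrite mem_next inC yb eqxx.
      by move: yn; rewrite -my yb eq_sym => /mbC/negP h /h.
    - by exists y; rewrite // my.
    - by exists (m y); rewrite // mK my setUC.
  move=> [x xc ->]; split; last exact: sM.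
  apply/imsetP; exists (m x); first by rewrite inC mK xc !orbT.
  have [c1 [c2 ec']] : exists c1 c2, c = c1 ++ x :: c2.
    by case/path.splitPr: xc => c1 c2; exists c1, c2.
  have eC : C = (b :: expand c1) ++ m x :: x :: expand c2.
    by rewrite /C ec' expand_cat expand_cons.
  by move: uC; rewrite eC => /next_adjacent ->; rewrite setUC.
rewrite card_in_imset; first by rewrite (card_uniqP _) ?(regular_uniq rc).
move=> x y xc yc E; have : x \in [set y; m y] by rewrite -E set21.
rewrite !inE => /orP[/eqP //|/eqP xy].
by have /andP[_ /allP/(_ y yc)] := rc; rewrite -xy xc.
Qed.

End Expand.

(** * Flowers and Tposies from paths with two tails *)

Section Configurations.
Variables (T : finType) (e : rel T).
Hypotheses (e_sym : symmetric e) (e_irr : irreflexive e).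
Implicit Types (m : T -> T) (b q u v x : T) (c Q : seq T).

Lemma flower0_V_T m u c v : max_mating e m -> m u = u -> blossom_walk e m u c ->
  v \in u :: c ++ map m c -> v \in V_T e.
Proof.
move=> hm mu hb vc; have [hM rM] := mating_setP hm.1; have mK := hm.1.1.
rewrite inE; apply/asboolP; left.
exists (mating_set m), (u :: expand m c), u, [::]; split.
- exact: max_mating_set.
- apply/and3P; split; first exact: (expand_blossom e_sym e_irr rM).
    by apply/and5P; split; rewrite //= (represented_unsaturated _ hM rM) mu.
  by apply/forallP => x; apply/implyP => /andP[_]; rewrite mem_seq1.
- move: vc; rewrite !in_cons !mem_cat !inE (mem_expand rM) (mem_map_mate mK).
  by case: (v == u); case: (v \in c); case: (m v \in c).
Qed.

(** The base is [m q], so the stem begins with the matching edge of [q]; it follows the nodes of [Q]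
    and ends with a nonmatching edge to the unsaturated vertex [u]. *)
Lemma flower_V_T m q Q u c v : max_mating e m -> path (step e m) q Q ->
  regular m (q :: Q) -> blossom_walk e m (m q) c -> apart m (q :: Q) c ->
  m u = u -> e (last q Q) u ->
  v \in u :: (q :: Q) ++ map m (q :: Q) ++ c ++ map m c -> v \in V_T e.
Proof.
move=> hm pQ rQ hb dQ mu eu hv; have [hM rM] := mating_setP hm.1.
have mK := hm.1.1.
rewrite inE; apply/asboolP; left.
have mq : m q != q by apply: (regular_fix rQ); rewrite mem_head.
have rQ' : regular m Q by move: rQ; rewrite (regular_cons mK) => /and3P[].
have uQ : u \notin q :: Q by apply/negP => /(regular_fix rQ); rewrite mu eqxx.
have muQ : m u \notin q :: Q by rewrite mu.
have emq : e (m q) q by rewrite e_sym; apply: (edge_mate rM).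
exists (mating_set m), (m q :: expand m c), (m q), (q :: rcons (expand m Q) u); split.
- exact: max_mating_set.
- apply/and3P; split; first exact: (expand_blossom e_sym e_irr rM).
    apply/and5P; split.
    + by rewrite /= emq rcons_path (expand_path e_sym rM) // last_expand.
    + have uE : uniq (expand m (q :: Q)) by exact: (expand_uniq rM).
      have : uniq (rcons (expand m (q :: Q)) u).
        by rewrite rcons_uniq uE andbT (mem_expand rM) negb_or uQ.
      by [].
    + by rewrite /= size_rcons size_expand /= odd_double.
    + rewrite /alternating /= -cats1 /walk_edges /= pairmap_cat /=.
      have Em : [set m q; q] \in mating_set m by rewrite rM.2 mq mK eqxx.
      have [h1 h2] := expand_alternating rM Em (regular_uniq rQ) rQ'.
      rewrite cat_path h1 /= h2 last_expand rM.2.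
      by rewrite (mate_eq mK) mu; case: eqP uQ => // <-; rewrite mem_last.
    + by rewrite /= last_rcons (represented_unsaturated _ hM rM) mu.
  apply/forallP => x; apply/implyP => /andP[].
  rewrite in_cons (mem_expand rM) => /predU1P[-> //|xc].
  rewrite inE => /orP[-> //|xQ].
  have : (x \in q :: Q) || (m x \in q :: Q) || (x == u).
    move: xQ; rewrite in_cons mem_rcons in_cons (mem_expand rM) !inE.
    by case: (x == q); case: (x == u); case: (x \in Q); case: (m x \in Q) => //; rewrite ?orbT.
  have /and4P[_ _ rc _] := hb.
  case/orP=> [|/eqP xu]; last first.
    by case/orP: xc; rewrite xu ?mu => /(regular_fix rc); rewrite mu eqxx.
  case/orP => xQ'; case/orP: xc => xc.
  + by rewrite (apart_mem dQ xQ') in xc.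
  + by have := apartP _ _ _ dQ _ xQ'; rewrite xc => -[].
  + by rewrite (apart_memm mK dQ xQ') in xc.
  + by rewrite (apart_mem dQ xQ') in xc.
- move: hv; rewrite !in_cons !mem_cat !(mem_map_mate mK) !in_cons mem_rcons in_cons !(mem_expand rM).
  rewrite (mate_eq mK).
  by case: (v == u); case: (v == q); case: (v == m q); case: (v \in c); case: (m v \in c);
     case: (v \in Q); case: (m v \in Q); rewrite ?orbT.
Qed.

(** The connecting path goes from [m q] to [last q Q] and both its end edges are matching edges. The
    two blossoms have to avoid the path but not each other. *)
Lemma tposy_V_T m q Q c0 c1 v : max_mating e m -> path (step e m) q Q ->
  regular m (q :: Q) -> blossom_walk e m (m q) c0 -> apart m (q :: Q) c0 ->
  blossom_walk e m (last q Q) c1 -> apart m (q :: Q) c1 ->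
  v \in (q :: Q) ++ map m (q :: Q) ++ c0 ++ map m c0 ++ c1 ++ map m c1 -> v \in V_T e.
Proof.
move=> hm pQ rQ hb0 dQ0 hb1 dQ1 hv; have [hM rM] := mating_setP hm.1.
have mK := hm.1.1.
rewrite inE; apply/asboolP; right.
have mq : m q != q by apply: (regular_fix rQ); rewrite mem_head.
have rQ' : regular m Q by move: rQ; rewrite (regular_cons mK) => /and3P[].
have emq : e (m q) q by rewrite e_sym; apply: (edge_mate rM).
have Em : [set m q; q] \in mating_set m by rewrite rM.2 mq mK eqxx.
have [h1 h2] := expand_alternating rM Em (regular_uniq rQ) rQ'.
have mqQ : m q \notin q :: Q.
  by have /andP[_ /allP] := rQ; apply; rewrite mem_head.
have nc x c : apart m (q :: Q) c -> (x \in q :: Q) || (m x \in q :: Q) -> x \notin expand m c.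
  move=> d /orP[] h; rewrite (mem_expand rM) negb_or.
    by have [-> ->] := apartP _ _ _ d _ h.
  by have [h1' h2'] := apartP _ _ _ d _ h; rewrite mK in h2'; rewrite h1' h2'.
have mem_p x : (x \in m q :: q :: expand m Q) = (x \in q :: Q) || (m x \in q :: Q).
  by rewrite -(mem_expand rM).
exists (mating_set m), (m q :: expand m c0), (last q Q :: expand m c1), (m q),
  (q :: expand m Q); split.
- exact: max_mating_set.
- have bl0 := expand_blossom e_sym e_irr rM hb0.
  have bl1 := expand_blossom e_sym e_irr rM hb1.
  apply/andP; split; last first.
    apply/forallP => x; apply/implyP; rewrite mem_p => xp.
    apply/implyP => /andP[xb]; rewrite /= last_expand => xl.
    by rewrite !in_cons !negb_or xb xl !nc.
  apply/and5P; split=> //=.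
  + by rewrite last_expand.
  (* The blossoms are distinct because the base [m q] of the first is not a vertex of the second. *)
  + apply/eqP => E.
    have : [set m q; next (m q :: expand m c0) (m q)] \in cycle_edges (m q :: expand m c0).
      by apply: imset_f; rewrite mem_head.
    rewrite E => /imsetP[y yc E'].
    have : m q \in [set y; next (last q Q :: expand m c1) y] by rewrite -E' set21.
    have : m q \in last q Q :: expand m c1 -> False.
      rewrite in_cons => /predU1P[h|]; first by rewrite h mem_last in mqQ.
      by apply/negP/nc; rewrite // mK mem_head orbT.
    move=> h; rewrite !inE => /orP[] /eqP h'; apply: h; rewrite h' //.
    by rewrite mem_next.
  + by rewrite emq (expand_path e_sym rM).
  + apply/and3P; split; first exact: (expand_uniq rM rQ).
      by rewrite /= size_expand odd_double.
    by apply/and3P; split.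
- move: hv; rewrite !mem_cat mem_p !(mem_map_mate mK) !(in_cons (m q)) !(in_cons (last q Q)).
  rewrite !(mem_expand rM).
  by case: (v \in q :: Q); case: (m v \in q :: Q); case: (v \in c0); case: (m v \in c0);
     case: (v \in c1); case: (m v \in c1); rewrite ?orbT.
Qed.

(** What may terminate the path [Q] at its end vertex [b]: a blossom with base [b] and apart from
    [Q], or an edge to an unsaturated vertex. *)
Definition tail m Q b c := blossom_walk e m b c && apart m Q c \/
  c = [::] /\ exists2 u, m u = u & e b u.

(** Two blossoms give a Tposy, and one blossom gives a flower, after reversing the path by duality
    if the blossom is at its end. With two unsaturated vertices the path would be augmenting unless
    they coincide, and then it closes up into a blossom with an unsaturated base. *)
Lemma tailed_path_V_T m q Q c0 c1 v : max_mating e m -> path (step e m) q Q ->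
  regular m (q :: Q) -> tail m (q :: Q) (m q) c0 -> tail m (q :: Q) (last q Q) c1 ->
  v \in (q :: Q) ++ map m (q :: Q) ++ c0 ++ map m c0 ++ c1 ++ map m c1 -> v \in V_T e.
Proof.
move=> hm pQ rQ; have mK := hm.1.1.
case=> [/andP[b0 d0]|[-> [u0 mu0 eu0]]]; case=> [/andP[b1 d1]|[-> [u1 mu1 eu1]]].
- exact: tposy_V_T b0 d0 b1 d1.
- move=> hv; apply: (@flower_V_T m q Q u1 c0) => //.
  by apply: mem_behead; move: hv; rewrite !cats0.
- move=> hv.
  have [s [S [ms lS eS pS]]] : exists s S, [/\ m s = last q Q, last s S = m q,
      s :: S = rev (map m (q :: Q)) & path (step e m) s S].
    case/lastP: (Q) pQ => [|Q1 z] pQ; first by exists (m q), [::]; rewrite mK.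
    exists (m z), (rcons (rev (map m Q1)) (m q)).
    rewrite mK !last_rcons map_cons rev_cons map_rcons rev_rcons rcons_cons.
    by split=> //; exact: path_dual.
  apply: (@flower_V_T m s S u0 c1) => //.
  + by rewrite eS regular_rev (regular_map mK).
  + by rewrite ms.
  + by rewrite eS apart_rev (apart_map mK).
  + by rewrite lS.
  + rewrite in_cons; apply/orP; right; move: hv; rewrite eS !mem_cat !(mem_map_mate mK) !mem_rev !(mem_map_mate mK) !mK.
    by case: (v \in q :: Q); case: (m v \in q :: Q); rewrite ?orbT.
- have [E|uv] := eqVneq u0 u1; last first.
    have f : e u0 (m q) by rewrite e_sym.
    have p : path (step e m) u0 (q :: Q) by rewrite /= [step _ _ _ _]f.
    by have := no_augmenting e_sym hm mu0 mu1 uv p rQ eu1.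
  rewrite /= !cats0 => hv; apply: (@flower0_V_T m u0 (q :: Q) v hm mu0); last by rewrite in_cons hv orbT.
  have uQ : u0 \notin q :: Q by apply/negP => /(regular_fix rQ); rewrite mu0 eqxx.
  apply/and4P; split=> //; last by rewrite apart1 mu0 uQ.
    by rewrite /= /step e_sym eu0.
  by rewrite /= E.
Qed.

End Configurations.

(** * Ears and lollipops *)

(** [normalize_apart] splits the regularity and apartness of compound sequences into facts about
    their pieces; [solve_apart] looks these up, up to symmetry, among the hypotheses. *)
Ltac split_conjunctions := repeat match goal with
  H : is_true (_ && _) |- _ => case/andP: H => ? ? end.

Ltac solve_apart := split_conjunctions;
  repeat match goal with |- is_true (_ && _) => apply/andP; split end;
  match goal with
  | |- is_true (regular _ [::]) => exact: regular_nil
  | |- is_true (apart _ [::] _) => exact: apart_nil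
  | mK : involutive ?m |- is_true (apart ?m _ [::]) => exact: (apart_nilr mK)
  | H : is_true ?p |- is_true ?p => exact: H
  | mK : involutive ?m, H : is_true (apart ?m ?p ?q) |- is_true (apart ?m ?q ?p) =>
    rewrite (apartC mK); exact: H
  | |- _ => idtac end.

Ltac normalize_apart mK := rewrite ?(regular_cat mK, regular_rev, regular_map mK, regular1, apart_catl,
  apart_catr mK, apart_rev, apart_revr mK, apart_map mK, apart_mapr mK, apart_m1 mK, apart_m1r mK).

Section Attached.
Variables (T : finType) (e : rel T).
Hypotheses (e_sym : symmetric e) (e_irr : irreflexive e).
Implicit Types (m : T -> T) (b h u v w x y z : T) (c s p P Q U W Z : seq T) (l : nat).

(* A lollipop ending at an unsaturated vertex [b] has an empty blossom [c]. *)
Definition closed_at m b c := if m b == b then nilp c else e (last b c) b.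

Definition lollipop m s b c :=
  [&& closed_at m b c, regular m (s ++ c) & apart m [:: b] (s ++ c)].

(* An ear (with [l = 0]) or a lollipop [s ++ b :: c] starting at [w]; only the
   length [l] of a stem matters for the induction. *)
Definition attached m W w p l :=
  [/\ w \in W, path (step e m) w p, apart m W p &
   ((exists2 z, z \in W & e (last w p) z) /\ regular m p) /\ l = 0
   \/ exists s b c, [/\ p = s ++ b :: c, lollipop m s b c & l = (size s).+1]].

Lemma lollipop_fixed m s b c : lollipop m s b c -> m b = b -> c = [::].
Proof. by case/and3P; rewrite /closed_at => + _ _ mb; rewrite mb eqxx => /nilP. Qed.

Lemma lollipop_closed m s b c : lollipop m s b c -> m b <> b -> e (last b c) b.
Proof. by case/and3P; rewrite /closed_at => + _ _ /eqP/negbTE mb; rewrite mb. Qed.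

Lemma lollipop_regular m s b c : involutive m -> lollipop m s b c -> m b <> b ->
  regular m (s ++ b :: c).
Proof.
move=> mK /and3P[_ + +] /eqP mb.
rewrite -(cat1s b c) (apart_catr mK) !(regular_cat mK) (apart_catr mK) regular1.
by move=> h1 h2; solve_apart.
Qed.

(** The only vertex of a lollipop that can be unsaturated is [b], and it is then the last one, so
    proper prefixes are regular. *)
Lemma lollipop_prefix m s b c p h P : involutive m -> lollipop m s b c ->
  s ++ b :: c = p ++ h :: P -> regular m p.
Proof.
move=> mK lo eP; have [mb|mb] := eqVneq (m b) b; last first.
  by move/eqP: mb => /(lollipop_regular mK lo); rewrite eP (regular_cat mK) => /andP[].
have [_ rsc _] := and3P lo; move: eP rsc; rewrite (lollipop_fixed lo mb) cats0.
case/lastP: P => [|P z]; rewrite ?cats1 => /eqP.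
  by rewrite eqseq_rcons => /andP[/eqP ->].
rewrite -rcons_cons -rcons_cat eqseq_rcons => /andP[/eqP -> _].
by rewrite (regular_cat mK) => /andP[].
Qed.

Lemma lollipop_prefix1 m s b c p h P : involutive m -> lollipop m s b c ->
  s ++ b :: c = p ++ h :: P -> m h <> h -> regular m (rcons p h).
Proof.
move=> mK lo eP mh; case: P eP => [|z P] eP; last first.
  by rewrite -(cat_rcons h p) in eP; exact: (lollipop_prefix mK lo eP).
rewrite -cats1 -eP; apply: lollipop_regular => // mb.
by move: eP; rewrite (lollipop_fixed lo mb) !cats1 => /rcons_inj[_ bh]; case: mh; rewrite -bh.
Qed.

(** An attachment is apart from [W], so it survives any change of the mates of vertices covered by
    [W], in particular an exchange. *)
Lemma eq_attached m m' W W' w p l : W =i W' ->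
  (forall x, apart m W [:: x] -> m' x = m x /\ apart m' W' [:: x]) ->
  involutive m -> involutive m' ->
  attached m W w p l -> attached m' W' w p l.
Proof.
move=> eW hm mK mK' [wW pp dp h].
have hp x : x \in p -> m' x = m x /\ apart m' W' [:: x].
  move=> xp; apply: hm; rewrite (apartC mK); apply: apart_sub (_ : apart m p W).
    by move=> y; rewrite inE => /eqP ->.
  by rewrite (apartC mK).
have mp : {in p, m =1 m'} by move=> x /hp[->].
have sE U : (forall x, x \in U -> x \in p) -> regular m U = regular m' U.
  move=> sU; rewrite /regular; congr andb; apply: eq_in_all => x xU.
  by rewrite mp ?sU.
split; rewrite -?eW //.
- by rewrite -[path _ _ _](eq_in_path_step _ _ mp).
- rewrite (apartC mK'); apply/apartP => x xp; have [_] := hp x xp.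
  by rewrite (apartC mK') apart1 => /andP[].
case: h => [[[[z zW ez] rp] l0]|[s [b [c [ep lo ls]]]]]; [left|right].
  by rewrite -sE //; split=> //; split=> //; exists z; rewrite -?eW.
exists s, b, c; split=> //; move: lo; rewrite /lollipop /closed_at !apart1.
rewrite -sE => [|x]; last by rewrite ep !mem_cat inE => /orP[->//|->]; rewrite !orbT.
by rewrite mp // ep mem_cat mem_head orbT.
Qed.

(** The sequence [P] holds the part of the walk since its last node in [Z]. The first edge leading
    to a vertex [m h] of [Z] closes an ear; the edge to [z] does so at the latest. *)
Lemma ear_between m Z y U z : involutive m -> y \in Z -> z \in Z ->
  path (step e m) y (rcons U (m z)) -> regular m U ->
  exists w p, attached m Z w p 0.
Proof.
move=> mK yZ zZ pU rU.
suff H P : apart m Z P -> path (step e m) y (P ++ rcons U (m z)) -> regular m (P ++ U) ->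
    exists w p, attached m Z w p 0 by exact: (H [::] (apart_nilr mK _)).
elim: U P y yZ {pU rU} => [|h U ih] P y yZ dP.
  rewrite cats0 /= cats1 rcons_path => /andP[pP]; rewrite /step mK => ez rP.
  by exists y, P; split=> //; left; split=> //; split=> //; exists z.
move=> pP rP.
have [hZ|hZ] := boolP (h \in Z).
  apply: (ih [::] h hZ (apart_nilr mK _)).
    by move: pP; rewrite cat_path /= => /and3P[].
  by move: rP; rewrite (regular_cat mK) (regular_cons mK) => /and3P[_ /and3P[]].
have [mhZ|mhZ] := boolP (m h \in Z).
  exists y, P; split=> //.
    by move: pP; rewrite cat_path => /andP[].
  left; split=> //; split.
    exists (m h) => //; by move: pP; rewrite cat_path /= => /and3P[].
  by move: rP; rewrite (regular_cat mK) => /and3P[].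
apply: (ih (rcons P h) y yZ).
- by rewrite (apart_rconsr mK) dP (apartC mK) apart1 hZ.
- by rewrite cat_rcons.
- by rewrite cat_rcons.
Qed.

(** If the blossom meets [Z] in a node, an ear starts there, follows the blossom to [b] and goes
    back along the stem to [y]; if [b] is in [Z], the tour of the blossom is used. If the mate of
    some node is in [Z], the walk up to there contains an ear. If a stem node is in [Z], the
    lollipop is restarted from it with a shorter stem. Otherwise the lollipop itself is attached. *)
Lemma lollipop_between m Z y s b c : involutive m -> (forall z, z \in Z -> m z <> z) ->
  y \in Z -> path (step e m) y (s ++ b :: c) -> lollipop m s b c ->
  exists w p l, attached m Z w p l /\ l <= (size s).+1.
Proof.
move=> mK nf; have [n] := ubnP (size s); elim: n => // n ih in y s * => sn yZ pp lo.
have [_ rsc dsc] := and3P lo.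
suff H : (exists w p, attached m Z w p 0) \/
  exists w p l, attached m Z w p l /\ l <= (size s).+1.
  by case: H => // -[w [p h]]; exists w, p, 0.
move: rsc dsc; rewrite (regular_cat mK) (apart_catr mK) => /and3P[rs rc dsc] /andP[dbs dbc].
have [/hasP[h hc hZ]|/hasPn cZ] := boolP (has (mem Z) c).
  left; have mb : m b <> b by move=> mb; rewrite (lollipop_fixed lo mb) in hc.
  have := lollipop_closed lo mb; case/path.splitPr: hc pp rc dsc dbc {lo} => c1 c2.
  rewrite -(cat1s h) (regular_cat mK) !(regular_cat mK) !(apart_catr mK) regular1 => pp rc dsc dbc eb.
  apply: (@ear_between _ _ h (c2 ++ m b :: rev (map m s)) y) => //.
    move: pp; rewrite cat_path /= cat_path /= => /and5P[pys lsb pbc1 lch pc2].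
    rewrite last_cat /= in eb.
    rewrite rcons_cat cat_path pc2 /= /step mK eb /=.
    by apply: (path_dual e_sym mK); rewrite rcons_path pys.
  rewrite -(cat1s (m b)) !(regular_cat mK) regular1 regular_rev (regular_map mK).
  rewrite (apart_catr mK) apart_m1 // apart_m1r // apart_revr // apart_mapr //.
  rewrite apart_revr // apart_mapr // mK eq_sym.
  by have /eqP mb' := mb; solve_apart.
have [bZ|bZ] := boolP (b \in Z).
  left; have mb := nf b bZ.
  apply: (@ear_between _ _ b c b) => //.
  rewrite rcons_path /step mK (lollipop_closed lo mb) andbT.
  by move: pp; rewrite cat_path /= => /and3P[].
have [/hasP[h hp hZ]|/hasPn pZ] := boolP (has (fun x => m x \in Z) (s ++ b :: c)).
  left; have [p1 [p2 eP]] : exists p1 p2, s ++ b :: c = p1 ++ h :: p2.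
    by case/path.splitPr: hp => p1 p2; exists p1, p2.
  apply: (@ear_between _ _ y p1 (m h)) => //.
    by rewrite mK -cats1; move: pp; rewrite eP -cat1s catA cat_path => /andP[].
  exact: (lollipop_prefix mK lo eP).
have [/hasP[h hs hZ]|/hasPn sZ] := boolP (has (mem Z) s).
  right; case/path.splitPr: hs sn pp lo rs dsc dbs => s1 s2 sn pp lo rs dsc dbs.
  have [||||w [p [l [h1 h2]]]] := ih h s2 => //.
  - by rewrite -ltnS; apply: leq_trans sn; rewrite ltnS size_cat /= addnS ltnS leq_addl.
  - by move: pp; rewrite -catA cat_path /= => /and3P[].
  - have /and3P[cl h1 h2] := lo; rewrite /lollipop cl; move: h1 h2; rewrite -(cat1s h).
    rewrite !(apart_catr mK) !(regular_cat mK) !apart_catl.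
    by move=> h1 h2; solve_apart.
  exists w, p, l; split=> //; apply: leq_trans h2 _.
  by rewrite size_cat /= ltnS addnS ltnW // ltnS leq_addl.
right; exists y, (s ++ b :: c), (size s).+1; split=> //; split=> //.
  rewrite (apartC mK); apply/apartP => x xp; split; last exact: pZ.
  by move: xp; rewrite mem_cat inE => /or3P[/sZ|/eqP ->|/cZ].
by right; exists s, b, c.
Qed.

End Attached.

Lemma first_split (T : Type) (a : pred T) (p : seq T) : has a p ->
  exists q y q', [/\ p = q ++ y :: q', a y & all (fun x => ~~ a x) q].
Proof.
elim: p => //= x p ih; have [ax _|nax /=] := boolP (a x).
  by exists [::], x, p.
by move=> /ih[q [y [q' [-> ay aq]]]]; exists (x :: q), y, q'; rewrite /= nax.
Qed.

Lemma cat_cons_eq (T : eqType) (s c q q' : seq T) (b y : T) :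
  s ++ b :: c = q ++ y :: q' ->
  [\/ exists2 s', s = q ++ y :: s' & q' = s' ++ b :: c,
      [/\ q = s, y = b & q' = c]
    | exists2 c', q = s ++ b :: c' & c = c' ++ y :: q'].
Proof.
elim: s q => [|x s ih] [|z q] /= [].
- by move=> -> ->; constructor 2.
- by move=> -> ->; constructor 3; exists q.
- by move=> -> <-; constructor 1; exists s.
- move=> -> /ih[[s' -> ->]|[-> -> ->]|[c' -> ->]].
  + by constructor 1; exists s'.
  + by constructor 2.
  + by constructor 3; exists c'.
Qed.

Lemma mem_middle (T : eqType) (v : T) (p q r s : seq T) :
  v \in q ++ r -> v \in p ++ q ++ r ++ s.
Proof. by rewrite !mem_cat => /orP[->|->]; rewrite ?orbT. Qed.

(** * Intersecting attachments: a new cycle with shorter stems *)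

Section Shorten.
Variables (T : finType) (e : rel T).
Hypotheses (e_sym : symmetric e) (e_irr : irreflexive e).
Implicit Types (m : T -> T) (b h u v w x y z : T) (c s p P Q U W Z L R : seq T) (l : nat).

Lemma attached_prefix m W w p h P l : involutive m ->
  attached e m W w (p ++ h :: P) l -> regular m p.
Proof.
move=> mK [_ _ _ [[[_ +] _]|[s [b [c [eP lo _]]]]]].
  by rewrite (regular_cat mK) => /andP[].
by apply: (lollipop_prefix mK lo); rewrite -eP.
Qed.

Lemma lollipop_blossom m w s b c : involutive m -> lollipop e m s b c -> m b <> b ->
  path (step e m) w (s ++ b :: c) -> blossom_walk e m b c.
Proof.
move=> mK lo mb; rewrite cat_path /= => /and3P[_ _ pc].
have [_ + +] := and3P lo; rewrite (regular_cat mK) (apart_catr mK) => /and3P[_ rc _] /andP[_ dc].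
by rewrite /blossom_walk pc (lollipop_closed lo mb) rc.
Qed.

(** Running through the blossom in the opposite direction exchanges its nodes with their mates and
    leaves the stem alone. *)
Lemma lollipop_flip m w s b c : involutive m -> lollipop e m s b c ->
  path (step e m) w (s ++ b :: c) ->
  lollipop e m s b (rev (map m c)) /\ path (step e m) w (s ++ b :: rev (map m c)).
Proof.
move=> mK lo pp; case: c lo pp => [|h c] // lo pp.
have mb : m b <> b by move=> /(lollipop_fixed lo).
have cl := lollipop_closed lo mb.
have /and3P[_ h1 h2] := lo; move: pp; rewrite cat_path => /andP[ps] /andP[lb pc].
have pb : path (step e m) b (rcons (h :: c) (m b)).
  by rewrite rcons_path {2}/step mK cl andbT.
have := path_dual e_sym mK pb.
rewrite mK rcons_path => /andP[pd ed]; split; last first.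
  by rewrite cat_path ps; apply/andP; split=> //; apply/andP.
rewrite /lollipop /closed_at; have /eqP/negbTE -> := mb.
move: ed; rewrite /step mK => ->; move: h1 h2.
rewrite !(regular_cat mK) regular_rev (regular_map mK) !(apart_catr mK) !(apart_revr mK) !(apart_mapr mK).
by move=> h1 h2; solve_apart.
Qed.

(* The two sides of a cycle [Z2] are [Z2] itself (white) and [map m Z2] (black). *)
Lemma reattach_black m Z2 s b c sa y sb w : involutive m ->
  m y <> y -> lollipop e m s b c ->
  path (step e m) w (s ++ b :: c) -> s ++ b :: c = sa ++ m y :: sb ->
  y \in Z2 -> (forall x, x \in sa -> m x \in Z2) ->
  (apart m sa sb -> apart m [:: y] sb -> apart m Z2 sb) ->
  exists w' p l, attached e m (map m Z2) w' p l /\ l <= size s.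
Proof.
move=> mK my lo pp ep yZ saZ dZ.
have pb : path (step e m) (m y) sb.
  by move: pp; rewrite ep cat_path /= => /and3P[].
have myZ : m y \in map m Z2 by rewrite (mem_map_mate mK) mK.
have /and3P[cl rsc dsc] := lo.
(* The rest of the lollipop after [m y] is attached at [m y]. If [m y] is on the stem, it is a
   lollipop with a shorter stem; if [m y] is the base, the tour of the blossom is an ear; if [m y]
   is on the blossom, the rest returns to [b], which is on the black side. *)
case: (cat_cons_eq ep) => [[s' es esb]|[es ey esb]|[c' es ec]].
- exists (m y), sb, (size s').+1; split; last by rewrite es size_cat /= addnS ltnS leq_addl.
  move: rsc dsc; rewrite es -(cat1s (m y)); normalize_apart mK => h1 h2.
  split=> //; last first.
    by right; exists s', b, c; split=> //; rewrite /lollipop cl; normalize_apart mK; solve_apart.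
  rewrite (apart_map mK) esb; rewrite esb in dZ.
  by apply: dZ; rewrite -(cat1s b); normalize_apart mK; solve_apart.
- subst sa; subst b; subst sb.
  exists (m y), c, 0; split=> //; move: rsc dsc; normalize_apart mK => h1 h2; split=> //.
    by rewrite (apart_map mK); apply: dZ; solve_apart.
  left; split=> //; split; last by solve_apart.
  by exists (m y) => //; apply: (lollipop_closed lo); rewrite mK => /esym.
- have mb : m b <> b by move=> mb; move: ec; rewrite (lollipop_fixed lo mb); case: (c').
  have := lollipop_closed lo mb; rewrite ec last_cat /= => eb.
  exists (m y), sb, 0; split=> //; move: rsc dsc.
  rewrite ec -(cat1s (m y)); normalize_apart mK => h1 h2; split=> //.
    by rewrite (apart_map mK); apply: dZ; rewrite ?es -?(cat1s b c'); normalize_apart mK; solve_apart.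
  left; split=> //; split; last by solve_apart.
  exists b => //; rewrite (mem_map_mate mK); apply: saZ.
  by rewrite es mem_cat mem_head orbT.
Qed.

(** The rest [q'] of the attachment after [y] is followed. An ear ending in [L] returns to [Z2]
    directly; one ending in [R] is continued backwards along [R] to [w]. For a lollipop, [y] on the
    stem leaves a lollipop starting at [y], while [y] on the blossom or at its base leads to an ear
    ending at the base. *)
Lemma reattach_white m L R w Z2 q y q' l : involutive m ->
  regular m (L ++ R) -> path (step e m) w R -> w \in L ->
  attached e m (L ++ R) w (q ++ y :: q') l -> m y <> y ->
  y \in Z2 -> {subset L <= Z2} -> {subset q <= Z2} -> (forall z, z \in Z2 -> m z <> z) ->
  exists w' p l', attached e m Z2 w' p l' /\ l' <= l.
Proof.
move=> mK rZ pR wL [_ pp dp att] my yZ LZ qZ nf.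
have pq : path (step e m) y q' by move: pp; rewrite cat_path /= => /and3P[].
case: att => [[[[z zZ ez] rp] ->]|[s [b [c [ep lo ->]]]]].
  suff [w' [p h]] : exists w' p, attached e m Z2 w' p 0 by exists w', p, 0.
  have rq : regular m q'.
    by move: rp; rewrite -(cat1s y); normalize_apart mK; move=> h; solve_apart.
  rewrite last_cat /= in ez; move: zZ; rewrite mem_cat => /orP[zL|zR].
    apply: (ear_between mK yZ (LZ z zL) _ rq).
    by rewrite rcons_path pq /step mK.
  case/path.splitPr: zR rZ pR dp => Ra Rb rZ pR dp.
  have pwz : path (step e m) w (rcons Ra z).
    by move: pR; rewrite -cat_rcons cat_path => /andP[].
  apply: (@ear_between _ _ m Z2 y (q' ++ m z :: rev (map m Ra)) w) => //; first exact: LZ.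
    by rewrite rcons_cat cat_path pq /= /step mK ez; exact: path_dual.
  move: rZ dp rp; rewrite -(cat1s y) -(cat1s z) -(cat1s (m z)); normalize_apart mK.
  by rewrite mK [z == _]eq_sym => h1 h2 h3; solve_apart.
case: (cat_cons_eq (esym ep)) => [[s' es eq']|[es ey eq']|[c' es ec]].
- have [||w' [p [l' [h1 h2]]]] := @lollipop_between _ _ e_sym m Z2 y s' b c mK nf yZ.
  + by rewrite -eq'.
  + have /and3P[cl] := lo; rewrite /lollipop cl es -(cat1s y); normalize_apart mK.
    by move=> h1 h2; solve_apart.
  exists w', p, l'; split=> //; apply: leq_trans h2 _.
  by rewrite es size_cat /= addnS ltnS ltnW // ltnS leq_addl.
- suff [w' [p h]] : exists w' p, attached e m Z2 w' p 0 by exists w', p, 0.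
  subst b; subst c; have /and3P[_ + _] := lo; rewrite (regular_cat mK) => /and3P[_ rq _].
  apply: (ear_between mK yZ yZ _ rq).
  by rewrite rcons_path pq /step mK (lollipop_closed lo).
- suff [w' [p h]] : exists w' p, attached e m Z2 w' p 0 by exists w', p, 0.
  have mb : m b <> b by move=> mb; move: ec; rewrite (lollipop_fixed lo mb); case: (c').
  have := lollipop_closed lo mb; rewrite ec last_cat /= => eb.
  have bZ : b \in Z2 by apply: qZ; rewrite es mem_cat mem_head orbT.
  apply: (@ear_between _ _ m Z2 y q' b) => //; first by rewrite rcons_path pq /step mK.
  have /and3P[_ + _] := lo; rewrite ec -(cat1s y); normalize_apart mK => h; solve_apart.
Qed.

(** The path goes back from [t] to the cycle along the first attachment, by duality, then along the
    arc, and leaves along the second attachment. *)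
Lemma ring_path m x0 L' q sa t : involutive m ->
  path (step e m) (m x0) (rcons sa t) -> path (step e m) x0 L' ->
  path (step e m) (last x0 L') q ->
  path (step e m) (m t) (rev (map m sa) ++ (x0 :: L') ++ q).
Proof.
move=> mK /(path_dual e_sym mK); rewrite mK -cats1 cat_path => /andP[p1] /andP[lx _] pL pq.
by rewrite cat_path p1 /= lx cat_path pL.
Qed.

Lemma shorten_stem m x0 L' R s b c p l v : max_mating e m ->
  regular m ((x0 :: L') ++ R) -> cycle (step e m) ((x0 :: L') ++ R) ->
  (v \in x0 :: L') || (m v \in x0 :: L') ->
  path (step e m) (m x0) (s ++ b :: c) -> lollipop e m s b c ->
  apart m ((x0 :: L') ++ R) (s ++ b :: c) ->
  attached e m ((x0 :: L') ++ R) (last x0 L') p l ->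
  ~~ apart m p (s ++ b :: c) ->
  v \in V_T e \/ exists Z2 w1 p1 l1 w2 p2 l2,
    [/\ regular m Z2, cycle (step e m) Z2, (v \in Z2) || (m v \in Z2),
     attached e m (map m Z2) w1 p1 l1 /\ attached e m Z2 w2 p2 l2
   & l1 + l2 <= size s + l].
Proof.
(* [y] is the first node of [p] on a matching edge of the lollipop.  If it is
   met on the stem in the direction of the lollipop, then the cycle through
   [v] and [y] is a blossom with base [m y]; otherwise it is alternating. *)
set L := x0 :: L' => hm rZ cZ vL ps lo dZs att; have mK := hm.1.1.
rewrite -has_predC => /first_split[q [y [q' [ep hy hq]]]]; subst p.
have rq := attached_prefix mK att.
have [_ pp dZp _] := att.
have [pq [lq pq']] : path (step e m) (last x0 L') q /\
    step e m (last (last x0 L') q) y /\ path (step e m) y q'.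
  by move: pp; rewrite cat_path /= => /and3P[].
have [pL pR] : path (step e m) x0 L' /\ path (step e m) (last x0 L') R.
  by move: cZ; rewrite /= rcons_path cat_path => /andP[/andP[]].
have dqs : apart m q (s ++ b :: c).
  by apply/allP => x /(allP hq); rewrite /= negbK.
have my_y : (y \in s ++ b :: c) || (m y \in s ++ b :: c).
  by move: hy; rewrite /= negb_and !negbK.
have rL : regular m L by move: rZ; normalize_apart mK => h; solve_apart.
have dLq : apart m L q by move: dZp; normalize_apart mK => h; solve_apart.
have dLs : apart m L (s ++ b :: c) by move: dZs; normalize_apart mK => h; solve_apart.
have dLy : apart m L [:: y] by move: dZp; rewrite -(cat1s y); normalize_apart mK => h; solve_apart.
have dqy : m y != y -> apart m q [:: y].
  move=> my; case: att => _ _ _ [[[_ rp] _]|[s1 [b1 [c1 [ep lo1 _]]]]].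
    by move: rp; rewrite -(cat1s y); normalize_apart mK => h; solve_apart.
  have := lollipop_prefix1 mK lo1 (esym ep) (elimN eqP my).
  by rewrite -cats1; normalize_apart mK => h; solve_apart.
have vd sa : v \in (rev (map m sa) ++ L ++ q) ++ map m (rev (map m sa) ++ L ++ q).
  move: vL; rewrite !mem_cat !(mem_map_mate mK) !mem_cat.
  by case: (v \in L); case: (m v \in L); rewrite ?orbT.
have [/eqP yb|yb] := boolP (y == b).
  (* The sequence [d] closes up into a blossom with base [m y]. If [y] is unsaturated this is a
     flower with an empty stem; otherwise the matching edge of [y] joins it to the blossom of the
     lollipop. *)
  left; subst b; set d := rev (map m s) ++ L ++ q.
  have psy : path (step e m) (m x0) (rcons s y).
    by move: ps; rewrite -cat_rcons cat_path => /andP[].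
  have /and3P[_ + +] := lo; move: dLs dqs; rewrite -(cat1s y); normalize_apart mK => h1 h2 h3 h4.
  have pd := ring_path mK psy pL pq.
  have ed : e (last (m y) d) (m y) by rewrite /d !last_cat /=; exact: lq.
  have rd : regular m d by rewrite /d; normalize_apart mK; solve_apart.
  have dd : apart m [:: y] d by rewrite /d; normalize_apart mK; solve_apart.
  have hb : blossom_walk e m (m y) d by rewrite /blossom_walk pd ed rd (apart_m1 mK).
  have [my|my] := eqVneq (m y) y.
    by rewrite my in hb; apply: (flower0_V_T e_sym e_irr hm my hb); rewrite in_cons vd orbT.
  apply: (@tailed_path_V_T _ _ e_sym e_irr m y [::] d c) => //.
  + by rewrite regular1.
  + by left; rewrite hb.
  + left; rewrite (lollipop_blossom mK lo (elimN eqP my) ps) /=.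
    by solve_apart.
  + by rewrite catA; exact: mem_middle (vd s).
have [ys|ys] := boolP (y \in s).
  left; case/path.splitPr: ys ps lo dLs dqs {dZs my_y hy hq} => sa sb ps lo dLs dqs.
  set d := rev (map m sa) ++ L ++ q.
  have psy : path (step e m) (m x0) (rcons sa y).
    by move: ps; rewrite -catA cat_cons -(cat_rcons y) cat_path => /andP[].
  have pb : path (step e m) y (sb ++ b :: c).
    by move: ps; rewrite -catA cat_path /= => /and3P[].
  have /and3P[_ + +] := lo; move: dLs dqs; rewrite -(cat1s y) -(cat1s b); normalize_apart mK => h1 h2 h3 h4.
  have pd := ring_path mK psy pL pq.
  have ed : e (last (m y) d) (m y) by rewrite /d !last_cat /=; exact: lq.
  have rd : regular m d by rewrite /d; normalize_apart mK; solve_apart.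
  have dd : apart m [:: y] d by rewrite /d; normalize_apart mK; solve_apart.
  have hb : blossom_walk e m (m y) d by rewrite /blossom_walk pd ed rd (apart_m1 mK).
  have vin U : v \in U ++ d ++ map m d ++ c ++ map m c.
    exact: mem_middle (vd sa).
  have [mb|mb] := eqVneq (m b) b.
    apply: (@tailed_path_V_T _ _ e_sym e_irr m y sb d c) => //.
    + by move: pb; rewrite cat_path => /andP[].
    + by rewrite -(cat1s y); normalize_apart mK; solve_apart.
    + by left; rewrite hb /= -(cat1s y) /d; normalize_apart mK; solve_apart.
    + right; split; first exact: (lollipop_fixed lo mb).
      by exists b => //; move: pb; rewrite cat_path /= /step mb => /and3P[].
    + by rewrite catA vin.
  apply: (@tailed_path_V_T _ _ e_sym e_irr m y (rcons sb b) d c) => //.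
  + by move: pb; rewrite -cat_rcons cat_path => /andP[].
  + by rewrite -cats1 -(cat1s y); normalize_apart mK; solve_apart.
  + by left; rewrite hb /= -cats1 -(cat1s y) /d; normalize_apart mK; solve_apart.
  + left; rewrite last_rcons (lollipop_blossom mK lo (elimN eqP mb) ps) /=.
    by rewrite -cats1 -(cat1s y); normalize_apart mK; solve_apart.
  + by rewrite catA vin.
right.
(* If the node [y] itself is on the lollipop, it is on the blossom, and reversing the blossom makes
   [m y] a node instead. *)
wlog myA : c ps lo dZs dLs dqs {my_y hy hq} / m y \in s ++ b :: c => [hwlog|].
  case/orP: my_y => [yA|]; last exact: hwlog.
  have yc : y \in c by move: yA; rewrite mem_cat inE (negbTE yb) (negbTE ys).
  have [lo' ps'] := lollipop_flip mK lo ps.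
  apply: (hwlog (rev (map m c))) => //.
  - by move: dZs; rewrite -(cat1s b c) -(cat1s b (rev _)); normalize_apart mK => h; solve_apart.
  - by move: dLs; rewrite -(cat1s b c) -(cat1s b (rev _)); normalize_apart mK => h; solve_apart.
  - by move: dqs; rewrite -(cat1s b c) -(cat1s b (rev _)); normalize_apart mK => h; solve_apart.
  - by rewrite mem_cat inE mem_rev (mem_map_mate mK) mK yc !orbT.
have my : m y != y.
  apply/eqP => my; have yc : y \in c.
    by move: myA; rewrite my mem_cat inE (negbTE yb) (negbTE ys).
  by have /and3P[_ + _] := lo; rewrite (regular_cat mK) => /and3P[_ /regular_fix/(_ yc)]; rewrite my eqxx.
have myP := elimN eqP my.
have [sa [sb eA]] : exists sa sb, s ++ b :: c = sa ++ m y :: sb.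
  by case/path.splitPr: myA => sa sb; exists sa, sb.
have psy : path (step e m) (m x0) (rcons sa (m y)).
  by move: ps; rewrite eA -(cat_rcons (m y)) cat_path => /andP[].
have rsa := lollipop_prefix1 mK lo eA.
rewrite mK in rsa; have {}rsa := rsa (nesym myP).
(* The new alternating cycle consists of [y], the first part of the lollipop run backwards, the arc
   [L] carrying [v], and [q]. The remaining parts of the two old attachments yield attachments on
   its two sides. As the old lollipop counted for [(size s).+1], the total length drops. *)
pose Z2 := y :: rev (map m sa) ++ L ++ q.
have rZ2 : regular m Z2.
  move: dLs dqs dLy (dqy my) rsa; rewrite eA -(cat1s (m y)) -cats1; normalize_apart mK => h1 h2 h3 h4 h5.
  by rewrite /Z2 -(cat1s y); normalize_apart mK; solve_apart.
have LZ : {subset L <= Z2} by move=> x xL; rewrite inE !mem_cat xL !orbT.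
have qZ : {subset q <= Z2} by move=> x xq; rewrite inE !mem_cat xq !orbT.
have [w1 [p1 [l1 [at1 le1]]]] : exists w' p l, attached e m (map m Z2) w' p l /\ l <= size s.
  apply: (@reattach_black m Z2 s b c sa y sb (m x0)) => //; first exact: mem_head.
    by move=> x xs; rewrite inE !mem_cat mem_rev map_f ?orbT.
  move=> h1 h2; move: dLs dqs; rewrite eA -(cat1s (m y)) /Z2 -(cat1s y); normalize_apart mK => h3 h4.
  by solve_apart.
have [w2 [p2 [l2 [at2 le2]]]] : exists w' p' l', attached e m Z2 w' p' l' /\ l' <= l.
  apply: (@reattach_white m L R (last x0 L') Z2 q y q' l) => //.
  - by rewrite /L mem_last.
  - exact: mem_head.
  - by move=> z /(regular_fix rZ2)/eqP.
exists Z2, w1, p1, l1, w2, p2, l2; split=> //; last by rewrite leq_add.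
- have := ring_path mK psy pL pq; rewrite mK => pZ.
  by rewrite /Z2 /= rcons_path pZ !last_cat /= last_cat.
- case/orP: vL => [/LZ ->//|/LZ ->]; exact: orbT.
Qed.

End Shorten.

(** * Two ears, or disjoint attachments *)

Section Finish.
Variables (T : finType) (e : rel T).
Hypotheses (e_sym : symmetric e) (e_irr : irreflexive e).
Implicit Types (m : T -> T) (b h q u v w x y z : T) (c s p t P Q U V W Z L R : seq T) (l : nat).

Lemma apart_tail m Q Q' b c : (apart m Q c -> apart m Q' c) ->
  tail e m Q b c -> tail e m Q' b c.
Proof.
move=> eQ [/andP[h1 h2]|h]; [left|by right].
by rewrite h1 eQ.
Qed.

(** The two walks leave the matching edge of [z] by its two ends; reversing the first one glues them
    into a single path. *)
Lemma tailed_walks_V_T m z V U c0 c1 v : max_mating e m ->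
  path (step e m) z V -> path (step e m) (m z) U -> regular m ((z :: V) ++ U) ->
  tail e m ((z :: V) ++ U) (last z V) c0 -> tail e m ((z :: V) ++ U) (last (m z) U) c1 ->
  (exists2 x, x \in ((z :: V) ++ U) ++ c0 ++ c1 & v = x \/ v = m x) -> v \in V_T e.
Proof.
move=> hm pV pU rVU t0 t1 [x xin vx]; have mK := hm.1.1.
have [q [Q [eQ mq pQ lQ]]] : exists q Q, [/\ q :: Q = rev (map m (z :: V)) ++ U,
    m q = last z V, path (step e m) q Q & last q Q = last (m z) U].
  case/lastP: V pV {rVU t0 t1 xin} => [|V y] pV; first by exists (m z), U; rewrite mK.
  exists (m y), (rcons (rev (map m V)) (m z) ++ U).
  rewrite map_cons rev_cons map_rcons rev_rcons mK last_rcons last_cat last_rcons.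
  split=> //.
  by rewrite cat_path last_rcons (path_dual e_sym mK pV).
have hd p : apart m ((z :: V) ++ U) p -> apart m (q :: Q) p.
  by rewrite eQ; normalize_apart mK.
apply: (@tailed_path_V_T _ _ e_sym e_irr m q Q c0 c1) => //.
- by rewrite eQ; move: rVU; normalize_apart mK.
- by rewrite mq; apply: apart_tail (hd c0) t0.
- by rewrite lQ; apply: apart_tail (hd c1) t1.
have hx : (x \in (q :: Q) ++ c0 ++ c1) || (m x \in (q :: Q) ++ c0 ++ c1).
  move: xin; rewrite eQ !mem_cat !mem_rev !(mem_map_mate mK) mK.
  by case: (x \in z :: V); case: (x \in U); case: (x \in c0); case: (x \in c1);
     rewrite ?orbT.
have : (v \in (q :: Q) ++ c0 ++ c1) || (m v \in (q :: Q) ++ c0 ++ c1).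
  by case: vx => ->; rewrite ?mK // orbC.
rewrite !mem_cat !(mem_map_mate mK).
by case: (v \in q :: Q); case: (m v \in q :: Q); case: (v \in c0); case: (m v \in c0);
   case: (v \in c1); case: (m v \in c1); rewrite ?orbT.
Qed.

Lemma cycle_sorted m Z : cycle (step e m) Z -> sorted (step e m) Z.
Proof. by case: Z => //= x Z; rewrite rcons_path => /andP[]. Qed.

(* The second end of an ear may lie on the arc [L], which then has to be shortened;
   the removed part [Lb] is absorbed by the blossom [c]. *)
Lemma cut_at_attachment m L w R p l : mating e m ->
  regular m (rcons L w ++ R) -> sorted (step e m) (rcons L w ++ R) ->
  attached e m (rcons L w ++ R) w p l ->
  exists P w' Lb t c,
  [/\ rcons L w = rcons P w' ++ Lb,
      path (step e m) w' t /\ regular m (rcons P w' ++ t),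
      {subset t <= p} /\ (l = 0 -> t = [::]),
      tail e m (rcons P w' ++ t) (last w' t) c &
      (forall x, x \in Lb -> m x \in c) /\
      (forall V, apart m V p -> apart m V (Lb ++ R) -> apart m V c)].
Proof.
move=> mm rZ sZ [wZ pp dZp att]; have mK := mm.1.
have pR : path (step e m) w R by move: sZ; rewrite cat_rcons => /cat_sorted2[].
move: (rZ); rewrite (regular_cat mK) => /and3P[rL rR dLR].
move: (dZp); rewrite apart_catl => /andP[dLp dRp].
case: att => [[[[z zZ ez] rp] l0]|[s [b [c [ep lo ->]]]]]; last first.
  have [mb|mb] := eqVneq (m b) b.
    exists L, w, [::], s, [::]; split; rewrite ?cats0 //.
    - split; first by move: pp; rewrite ep cat_path => /andP[].
      move: dLp; rewrite ep -(cat1s b); have /and3P[_ + _] := lo; normalize_apart mK => h1 h2.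
      by solve_apart.
    - by split=> // x; rewrite ep mem_cat => ->.
    - right; split=> //; exists b => //.
      by move: pp; rewrite ep cat_path /= {2}/step mb => /and3P[].
    - by split=> // V _ _; exact: apart_nilr.
  exists L, w, [::], (rcons s b), c.
  have /and3P[_ + +] := lo; move: dLp rL; rewrite ep -(cat1s b) -cats1; normalize_apart mK => h1 h4 h2 h3.
  split; rewrite ?cats0 //.
  - split; first by move: pp; rewrite ep -cat_rcons cat_path => /andP[].
    by rewrite -!cats1; normalize_apart mK; solve_apart.
  - by split=> // x; rewrite -cats1 mem_cat => xs; rewrite !mem_cat; case/orP: xs => ->; rewrite ?orbT.
  - left; rewrite last_rcons -!cats1; rewrite ep in pp.
    by rewrite (lollipop_blossom mK lo (elimN eqP mb) pp); normalize_apart mK; solve_apart.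
  - by split=> // V; normalize_apart mK => h5 _; solve_apart.
have pwz : path (step e m) w (rcons p (m z)) by rewrite rcons_path pp /step mK.
have zin : [|| z == w, z \in R | z \in L].
  by move: zZ; rewrite mem_cat mem_rcons inE; case: (z == w); case: (z \in L); case: (z \in R).
(* An ear back to [w] is itself a blossom. One ending in [R] is closed by going back along [R] to
   [w]. One ending at [z] in [L] cuts the arc at [z]: the blossom based at [z] follows the ear
   backwards to [w], then the removed part of the arc backwards to [z]. *)
case/or3P: zin => [/eqP zw|zR|zL].
- subst z; exists L, w, [::], [::], p; split; rewrite ?cats0 //.
  + left; rewrite /blossom_walk pp /= ez rp dLp andbT.
    by move: dLp; rewrite -cats1; normalize_apart mK => h; solve_apart.
- case/path.splitPr: zR rZ pR rR dLR dRp {sZ dZp wZ zZ} => Ra Rb rZ pR rR dLR dRp.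
  have pwz' : path (step e m) w (rcons Ra z).
    by move: pR; rewrite -cat_rcons cat_path => /andP[].
  exists L, w, [::], [::], (p ++ rev (map m (rcons Ra z))).
  move: rL rR dLR dRp dLp; rewrite -(cat1s z) -!cats1; normalize_apart mK => h0 h1 h2 h3 h4.
  split; rewrite ?cats0 //.
  + by split=> //; normalize_apart mK; solve_apart.
  + left; apply/andP; split; last by normalize_apart mK; solve_apart.
    have := path_dual e_sym mK pwz'; rewrite cats1 map_rcons rev_rcons rcons_path /step mK.
    move=> /andP[p1 e1]; apply/and4P; split.
    * by move: pwz; rewrite rcons_path cat_path /= => /andP[-> ->].
    * by rewrite last_cat /=.
    * by rewrite -(cat1s (m z)); normalize_apart mK; rewrite mK [z == _]eq_sym; solve_apart.
    * by rewrite -(cat1s (m z)); normalize_apart mK; solve_apart.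
  + by split=> // V; normalize_apart mK => h5 h6; solve_apart.
- case/path.splitPr: zL rZ sZ rL dLR dLp {dZp wZ zZ} => A B rZ sZ rL dLR dLp.
  have pzw : path (step e m) z (rcons B w).
    by move: sZ => /cat_sorted2[]; rewrite rcons_cat => /cat_sorted2[].
  exists A, z, (rcons B w), [::], (rev (map m p) ++ rev (map m (rcons B w))).
  have d1 := path_dual e_sym mK pwz; have d2 := path_dual e_sym mK pzw.
  rewrite mK in d1; move: d1; rewrite rcons_path => /andP[d1 e1].
  move: rL dLR dLp; rewrite -(cat1s z) -!cats1; normalize_apart mK => h1 h2 h3.
  split; rewrite ?cats0 //.
  + by rewrite -!catA.
  + by split=> //; normalize_apart mK; solve_apart.
  + left; apply/andP; split; last by normalize_apart mK; solve_apart.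
    move: d2; rewrite rcons_path /step mK => /andP[d2 e2].
    rewrite cats1 map_rcons rev_rcons; apply/and4P; split.
    * by rewrite cat_path d1 /= e1.
    * by rewrite last_cat /=.
    * by rewrite -(cat1s (m w)); normalize_apart mK; rewrite mK [w == _]eq_sym; solve_apart.
    * by rewrite -(cat1s (m w)); normalize_apart mK; solve_apart.
  + split=> [x xB|V]; last by normalize_apart mK => h5 h6; solve_apart.
    by rewrite mem_cat !mem_rev (mem_map_mate mK) mK (mem_map_mate mK) mK xB orbT.
Qed.

(** The arc is cut at both ends; what is kept, extended by the two stems, is a path with two tails.
    Each stem has to avoid the other attachment, but the blossoms may meet, so two ears, whose stems
    are empty, are allowed to intersect. *)
Lemma apart_attachments_V_T m x0 L R v p0 l0 p1 l1 : max_mating e m ->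
  regular m ((x0 :: L) ++ R) -> cycle (step e m) ((x0 :: L) ++ R) ->
  (v \in x0 :: L) || (m v \in x0 :: L) ->
  attached e m (map m ((x0 :: L) ++ R)) (m x0) p0 l0 ->
  attached e m ((x0 :: L) ++ R) (last x0 L) p1 l1 ->
  l0 = 0 /\ l1 = 0 \/ apart m p0 p1 -> v \in V_T e.
Proof.
move=> hm rZ cZ vL at0 at1 d01; have [mm _] := hm; have mK := mm.1.
have [_ _ dp0 _] := at0; have [_ _ dp1 _] := at1; rewrite (apart_map mK) in dp0.
have [L1 [w [eL ew]]] : exists L1 w, x0 :: L = rcons L1 w /\ last x0 L = w.
  by exists (belast x0 L), (last x0 L); rewrite -lastI.
have rZ1 := rZ; have sZ1 := cycle_sorted cZ; have at1' := at1.
rewrite eL ?ew in rZ1 sZ1 at1'.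
have [P [w' [Lb [t1 [c1 [eP [pt1 rP] [st1 l1t] tl1 [Lbc1 dc1]]]]]]] := cut_at_attachment mm rZ1 sZ1 at1'.
have [P2 eP2] : exists P2, rcons P w' = x0 :: P2.
  move: eP; rewrite -eL; case: (P) => [|y P'] [<- _]; first by exists [::].
  by exists (rcons P' w').
(* The part of the arc kept by the first cut, seen from the black side: it runs from [m w'] to
   [m x0], where the second cut is made. *)
pose D := rev (map m (rcons P w')); pose RD := rev (map m (Lb ++ R)).
have eD : D = rcons (rev (map m P2)) (m x0) by rewrite /D eP2 map_cons rev_cons.
have eZ : (x0 :: L) ++ R = rcons P w' ++ Lb ++ R by rewrite eL eP catA.
have rD : regular m (D ++ RD) by move: rZ; rewrite eZ /D /RD; normalize_apart mK => h; solve_apart.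
have cD : cycle (step e m) (D ++ RD).
  have := cycle_dual e_sym mK cZ; rewrite eZ map_cat rev_cat -/D -/RD => h.
  by rewrite -(rot_cycle (size D)) rot_size_cat.
have sD := cycle_sorted cD.
have at0' : attached e m (D ++ RD) (m x0) p0 l0.
  have eW : map m ((x0 :: L) ++ R) =i D ++ RD.
    by move=> x; rewrite eZ !map_cat !mem_cat /D /RD !mem_rev map_cat mem_cat.
  apply: (eq_attached eW) at0 => // x; split=> //.
  by rewrite -(eq_apartl _ _ eW).
rewrite eD in rD sD at0'.
have [P3 [w3 [Lb3 [t0 [c0 [eP3 [pt0 rP3] [st0 l0t] tl0 [Lbc0 dc0]]]]]]] := cut_at_attachment mm rD sD at0'.
have [V3 eK] : exists V3, rcons P3 w3 = m w' :: V3.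
  move: eP3; rewrite -eD /D map_rcons rev_rcons.
  case: (P3) => [|y P'] [<- _]; first by exists [::].
  by exists (rcons P' w3).
have lV3 : last (m w') V3 = w3 by rewrite -(last_cons (m w')) -eK last_rcons.
have pV3 : path (step e m) (m w') V3.
  by move: sD; rewrite eP3 -catA => /cat_sorted2[]; rewrite eK.
have dZt0 : apart m ((x0 :: L) ++ R) t0.
  by rewrite (apartC mK); apply: apart_sub st0 _; rewrite (apartC mK).
have dZt1 : apart m ((x0 :: L) ++ R) t1.
  by rewrite (apartC mK); apply: apart_sub st1 _; rewrite (apartC mK).
have dt0p1 : apart m t0 p1.
  by case: d01 => [[/l0t -> _]//|d]; apply: apart_sub st0 d.
have dt1p0 : apart m t1 p0.
  by case: d01 => [[_ /l1t ->]//|d]; apply: apart_sub st1 _; rewrite (apartC mK).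
have dt0t1 : apart m t0 t1.
  by rewrite (apartC mK); apply: apart_sub st1 _; rewrite (apartC mK).
have eDK : rev (map m (rcons P w')) = rcons P3 w3 ++ Lb3 by rewrite -/D eD eP3.
have dK U : apart m (rcons P w') U -> apart m (rcons P3 w3) U.
  move=> h; have : apart m (rcons P3 w3 ++ Lb3) U by rewrite -eDK; normalize_apart mK.
  by rewrite apart_catl => /andP[].
have dLb3 U : apart m (rcons P w') U -> apart m Lb3 U.
  move=> h; have : apart m (rcons P3 w3 ++ Lb3) U by rewrite -eDK; normalize_apart mK.
  by rewrite apart_catl => /andP[].
have dPt1 : apart m (rcons P w') t1 by move: rP; normalize_apart mK => h; solve_apart.
have dKt1 := dK _ dPt1.
have eKt : (m w' :: V3 ++ t0) ++ t1 = rcons P3 w3 ++ t0 ++ t1 by rewrite eK /= catA.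
apply: (@tailed_walks_V_T m (m w') (V3 ++ t0) t1 c0 c1) => //.
- by rewrite cat_path pV3 lV3.
- by rewrite mK.
- by rewrite eKt; move: rP3 rP; normalize_apart mK => h1 h2; solve_apart.
- rewrite last_cat lV3 eKt; apply: apart_tail tl0 => h.
  have dt1c0 : apart m t1 c0.
    apply: dc0 => //; rewrite (apartC mK) apart_catl (dLb3 _ dPt1) /RD.
    by move: dZt1; rewrite eZ; normalize_apart mK => h1; solve_apart.
  by move: h; normalize_apart mK => h; solve_apart.
- rewrite mK eKt; apply: apart_tail tl1 => h.
  have dt0c1 : apart m t0 c1.
    apply: dc1 => //; rewrite (apartC mK).
    by move: dZt0; rewrite eZ; normalize_apart mK => h1; solve_apart.
  by move: h; normalize_apart mK => /andP[/dK h1 h2]; solve_apart.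
rewrite eKt.
(* A vertex of the arc that is not on the kept part has been absorbed by one of the two blossoms. *)
have [x xL vx] : exists2 x, x \in rcons P w' ++ Lb & v = x \/ v = m x.
  case/orP: vL; rewrite eL eP => h; first by exists v => //; left.
  by exists (m v) => //; right; rewrite mK.
move: xL; rewrite mem_cat => /orP[xP|xLb]; last first.
  exists (m x); first by rewrite !mem_cat Lbc1 ?orbT.
  by case: vx => ->; [right; rewrite mK|left].
have : m x \in rcons P3 w3 ++ Lb3 by rewrite -eDK mem_rev map_f.
rewrite mem_cat => /orP[xP3|xLb3].
  exists (m x); first by rewrite !mem_cat xP3.
  by case: vx => ->; [right; rewrite mK|left].
have := Lbc0 _ xLb3; rewrite mK => xc0.
by exists x => //; rewrite !mem_cat xc0 !orbT.
Qed.

End Finish.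

(** * Induction on the stems, and closed walks through a vertex *)

Section Ring.
Variables (T : finType) (e : rel T).
Hypotheses (e_sym : symmetric e) (e_irr : irreflexive e).
Implicit Types (m : T -> T) (b h q u v w x y z : T) (c s p t P Q U V W Z L R : seq T) (l : nat).

(** One of the two arcs between the attachments carries [v], possibly after an exchange along [Z].
    The exchange affects neither the attachments, which are apart from [Z], nor the unsaturated
    vertices, so maximality is kept. *)
Lemma arc_attached m Z w0 p0 l0 w1 p1 l1 v : max_mating e m ->
  regular m Z -> cycle (step e m) Z -> (v \in Z) || (m v \in Z) ->
  attached e m (map m Z) w0 p0 l0 -> attached e m Z w1 p1 l1 ->
  exists m' x0 L R,
  [/\ max_mating e m',
      regular m' ((x0 :: L) ++ R) /\ cycle (step e m') ((x0 :: L) ++ R),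
      (v \in x0 :: L) || (m' v \in x0 :: L),
      attached e m' (map m' ((x0 :: L) ++ R)) (m' x0) p0 l0 /\
      attached e m' ((x0 :: L) ++ R) (last x0 L) p1 l1
    & apart m' p0 p1 = apart m p0 p1].
Proof.
move=> hm rZ cZ vZ at0 at1; have [mm mmax] := hm; have mK := mm.1.
have [w0Z _ d0 _] := at0; have [w1Z _ _ _] := at1.
rewrite (mem_map_mate mK) in w0Z; rewrite (apart_map mK) in d0.
have [m' [L [R [[mm' fE] [rZ' cZ'] [eZ mZ] off [[L' eL] lL vL]]]]] :=
  arc_through e_sym mm rZ cZ w0Z w1Z vZ.
have mK' := mm'.1.
have hm' : max_mating e m'.
  split=> // m2 /mmax; congr (_ <= _); apply: eq_card => x; by rewrite !inE fE.
subst L; rewrite /= in lL.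
have eW : map m Z =i map m' ((m' w0 :: L') ++ R).
  by move=> x; rewrite !mem_map_mate // eZ mZ.
have offE x : apart m Z [:: x] -> m' x = m x /\ apart m' ((m' w0 :: L') ++ R) [:: x].
  rewrite (apartC mK) apart1 => /andP[xZ mxZ]; rewrite off //; split=> //.
  by rewrite (apartC mK') apart1 !eZ xZ mZ.
exists m', (m' w0), L', R; split=> //.
- rewrite mK' lL; split.
    apply: (eq_attached eW _ mK mK' at0) => x; rewrite (apart_map mK) => /offE[-> h].
    by rewrite (apart_map mK').
  apply: (eq_attached _ _ mK mK' at1) => x; first by rewrite eZ.
  exact: offE.
- apply: eq_in_all => x xp.
  have [-> //] : m' x = m x /\ apart m' ((m' w0 :: L') ++ R) [:: x].
  apply: offE; rewrite (apartC mK); apply: apart_sub (_ : apart m p0 Z).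
    by move=> y; rewrite inE => /eqP ->.
  by rewrite (apartC mK).
Qed.

(** Induction on the total length of the stems: attachments that meet and are not both ears are
    replaced by shorter ones, and all other cases are settled directly. *)
Lemma ring_V_T n m Z w0 p0 l0 w1 p1 l1 v : l0 + l1 < n -> max_mating e m ->
  regular m Z -> cycle (step e m) Z -> (v \in Z) || (m v \in Z) ->
  attached e m (map m Z) w0 p0 l0 -> attached e m Z w1 p1 l1 -> v \in V_T e.
Proof.
elim: n m Z w0 p0 l0 w1 p1 l1 => // n ih m Z w0 p0 l0 w1 p1 l1 ln hm rZ cZ vZ at0 at1.
have short m1 Z1 u0 (q0 : seq T) k0 u1 (q1 : seq T) k1 : k0 + k1 < n.+1 -> max_mating e m1 ->
    regular m1 Z1 -> cycle (step e m1) Z1 -> (v \in Z1) || (m1 v \in Z1) ->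
    attached e m1 (map m1 Z1) u0 q0 k0 -> attached e m1 Z1 u1 q1 k1 ->
    k0 != 0 -> ~~ apart m1 q0 q1 -> v \in V_T e.
  move=> kn hm1 rZ1 cZ1 vZ1 a0 a1 k00 nd.
  have [m' [x0 [L [R [hm' [rLR cLR] vL [a0' a1'] dE]]]]] :=
    arc_attached hm1 rZ1 cZ1 vZ1 a0 a1.
  have mK' := hm'.1.1; have [_ pq dq] := a0'.
  case=> [[_ k0E]|[s [b [c [eq lo kE]]]]]; first by rewrite k0E in k00.
  subst q0 k0; rewrite (apart_map mK') in dq.
  have nd' : ~~ apart m' q1 (s ++ b :: c) by rewrite (apartC mK') dE.
  have [//|[Z2 [w2 [p2 [l2 [w3 [p3 [l3 [r2 c2 v2 [at2 at3] l23]]]]]]]]] :=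
    shorten_stem e_sym e_irr hm' rLR cLR vL pq lo dq a1' nd'.
  apply: (ih m' Z2 w2 p2 l2 w3 p3 l3) => //.
  by move: kn; rewrite addSn ltnS; apply: leq_ltn_trans.
have mK := hm.1.1.
have [d01|nd] := boolP (apart m p0 p1).
  have [m' [x0 [L [R [hm' [rLR cLR] vL [a0' a1'] dE]]]]] :=
    arc_attached hm rZ cZ vZ at0 at1.
  apply: (apart_attachments_V_T e_sym e_irr hm' rLR cLR vL a0' a1').
  by right; rewrite dE.
have [l00|l00] := eqVneq l0 0; last exact: short at0 at1 l00 nd.
have [l10|l10] := eqVneq l1 0.
  have [m' [x0 [L [R [hm' [rLR cLR] vL [a0' a1'] dE]]]]] :=
    arc_attached hm rZ cZ vZ at0 at1.
  by apply: (apart_attachments_V_T e_sym e_irr hm' rLR cLR vL a0' a1'); left.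
(* Only the white attachment is a lollipop; passing to the dual cycle exchanges the two sides. *)
apply: (short m (rev (map m Z)) w1 p1 l1 w0 p0 l0) => //.
- by rewrite addnC.
- by rewrite regular_rev (regular_map mK).
- exact: cycle_dual.
- by rewrite !mem_rev !(mem_map_mate mK) mK orbC.
- apply: (eq_attached _ _ mK mK at1) => [x|x].
    by rewrite map_rev mem_rev !(mem_map_mate mK) mK.
  by rewrite (apart_map mK) apart_rev (apart_map mK).
- apply: (eq_attached _ _ mK mK at0) => [x|x]; first by rewrite mem_rev.
  by rewrite apart_rev.
- by rewrite (apartC mK).
Qed.

(** The path is followed until the first node [h] that is unsaturated or whose mate has already been
    visited. In the latter case, the edge to [m h] closes a blossom with base [m h]. *)
Lemma lollipop_in_path m w U : involutive m -> path (step e m) w U -> uniq U ->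
  regular m U \/ exists s b c, [/\ path (step e m) w (s ++ b :: c), lollipop e m s b c
    & {subset s ++ b :: c <= U}].
Proof.
move=> mK pU uU.
suff H P : regular m P -> uniq (P ++ U) -> path (step e m) w (P ++ U) ->
    regular m (P ++ U) \/ exists s b c, [/\ path (step e m) w (s ++ b :: c), lollipop e m s b c
      & {subset s ++ b :: c <= P ++ U}] by exact: (H [::]).
elim: U P {pU uU} => [|h U ih] P rP uPU pPU; first by rewrite cats0; left.
have pPh : path (step e m) w (rcons P h).
  by move: pPU; rewrite -cat_rcons cat_path => /andP[].
have hP : h \notin P.
  by move: uPU; rewrite cat_uniq /= negb_or => /and3P[_ /andP[]].
have [mh|mh] := eqVneq (m h) h.
  right; exists P, h, [::]; split; first by rewrite cats1.
    by rewrite /lollipop /closed_at mh eqxx cats0 rP /= apart1 mh hP.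
  by move=> x; rewrite !mem_cat !inE => /orP[->//|/eqP ->]; rewrite eqxx orbT.
have [mhP|mhP] := boolP (m h \in P).
  right; case/path.splitPr: mhP rP pPh uPU {ih pPU hP} => s c rP pPh uPU.
  exists s, (m h), c; split.
  - by move: pPh; rewrite rcons_path => /andP[].
  - move: pPh; rewrite rcons_path last_cat /= /step => /andP[_ eh].
    rewrite /lollipop /closed_at mK eq_sym (negbTE mh) eh.
    by move: rP; rewrite -(cat1s (m h) c); normalize_apart mK => h1; solve_apart.
  - by move=> x xs; rewrite mem_cat xs.
rewrite -cat_rcons; apply: ih; rewrite ?cat_rcons //.
by rewrite regular_rcons // rP mh (apartC mK) apart1 hP.
Qed.

(** The last arc of a walk to [m v] is an edge to [v]. If the inner nodes are regular, they form an
    ear from [v] to [v]; otherwise they contain a lollipop. *)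
Lemma attached_to_mate m v : involutive m -> m v != v -> connect (step e m) v (m v) ->
  exists p l, attached e m [:: v] v p l.
Proof.
move=> mK mv /connectP[p pp lp]; case/shortenP: pp lp => {}p pp up _ lp.
case/lastP: p pp up lp => [|U z] pp up lp; first by rewrite /= lp eqxx in mv.
rewrite last_rcons in lp; subst z.
have [vU mvU uU] : [/\ v \notin U, m v \notin U & uniq U].
  by move: up; rewrite /= mem_rcons inE negb_or rcons_uniq => /andP[/andP[_ ->] /andP[-> ->]].
move: pp; rewrite rcons_path /step mK => /andP[pU eU].
have [rU|[s [b [c [ps lo sU]]]]] := lollipop_in_path mK pU uU.
  exists U, 0; split; rewrite ?mem_head ?apart1 ?vU //.
  by left; split=> //; split=> //; exists v; rewrite ?mem_head.
exists (s ++ b :: c), (size s).+1; split; rewrite ?mem_head // ?apart1.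
  by apply/andP; split; [apply: contra vU|apply: contra mvU]; exact: sU.
by right; exists s, b, c.
Qed.

Lemma connect_mate_V_T m v : max_mating e m -> m v != v ->
  connect (step e m) v (m v) -> connect (step e m) (m v) v -> v \in V_T e.
Proof.
move=> hm mv c1 c0; have mK := hm.1.1.
have [p1 [l1 at1]] := attached_to_mate mK mv c1.
have [p0 [l0 at0]] : exists p l, attached e m [:: m v] (m v) p l.
  by apply: attached_to_mate => //; rewrite mK // eq_sym.
apply: (@ring_V_T (l0 + l1).+1 m [:: v] (m v) p0 l0 v p1 l1) => //.
- by rewrite regular1.
(* The loop at [v] in the digraph is its matching edge. *)
- by rewrite /= /step; case: (hm.1.2 v) => [h|->//]; rewrite h eqxx in mv.
- by rewrite mem_head.
Qed.

(** If the inner nodes of a shortest such return are regular, they form a blossom with unsaturated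
    base [v]. Otherwise they contain a lollipop; its end is saturated, as there is no augmenting
    path, and its stem reversed is the stem of a flower ending at [v]. *)
Lemma closed_walk_V_T m v x : max_mating e m -> m v = v ->
  step e m v x -> connect (step e m) x v -> v \in V_T e.
Proof.
move=> hm mv vx /connectP[p pp lp]; have mK := hm.1.1.
case/shortenP: pp lp => {}p pp up _ lp.
have xv : x != v by apply: contraTneq vx => ->; rewrite /step mv e_irr.
case/lastP: p pp up lp => [|U z] pp up lp; first by rewrite lp eqxx in xv.
rewrite last_rcons in lp; subst z.
set V := x :: U.
have uV : uniq (rcons V v) by [].
have pV : path (step e m) v (rcons V v) by rewrite /= vx.
move: uV; rewrite rcons_uniq => /andP[vV uV].
move: pV; rewrite rcons_path {2}/step mv => /andP[pV eV].
have [rV|[s [b [c [ps lo sV]]]]] := lollipop_in_path mK pV uV.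
  have hb : blossom_walk e m v V by rewrite /blossom_walk pV eV rV apart1 mv vV.
  by apply: (flower0_V_T e_sym e_irr hm mv hb); rewrite mem_head.
have bV : b \in V by apply: sV; rewrite mem_cat mem_head orbT.
have pb : path (step e m) v (rcons s b).
  by move: ps; rewrite -cat_rcons cat_path => /andP[].
have /and3P[_ rsc dsc] := lo.
have [mb|mb] := eqVneq (m b) b.
  have vb : v != b by apply: contraNneq vV => ->.
  move: pb rsc; rewrite rcons_path (lollipop_fixed lo mb) cats0 {2}/step mb => /andP[p1 e1] rs.
  by have := no_augmenting e_sym hm mv mb vb p1 rs e1.
have := path_dual e_sym mK pb; rewrite rcons_path {2}/step mK => /andP[p1 e1].
apply: (@flower_V_T _ _ e_sym e_irr m (m b) (rev (map m s)) v c) => //.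
- by move: rsc dsc; rewrite -(cat1s (m b)); normalize_apart mK; rewrite mK [b == _]eq_sym => h1 h2; solve_apart.
- by rewrite mK; apply: (lollipop_blossom mK lo (elimN eqP mb) ps).
- by move: rsc dsc; rewrite -(cat1s (m b)); normalize_apart mK => h1 h2; solve_apart.
- by rewrite mem_head.
Qed.

End Ring.

(** * Walks of nodes from Jflowers and Jposies *)

Lemma next_next_neq (T : eqType) (c : seq T) (y : T) :
  uniq c -> 2 < size c -> y \in c -> next c (next c y) != y.
Proof.
move=> uc sc /rot_to[i s es].
have := uc; rewrite -(rot_uniq i) es => us.
rewrite -!(next_rot i uc) es.
have : 2 < size (y :: s) by rewrite -es size_rot.
case: s es us => [|a [|b s]] // es us _.
rewrite (@next_adjacent _ [::] y a (b :: s)) //.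
rewrite (@next_adjacent _ [:: y] a b s) //.
by move: us; rewrite /= !inE !negb_or => /andP[/and3P[_ yb _] _]; rewrite eq_sym.
Qed.

Section Blossom.
Variables (T : finType) (e : rel T) (m : T -> T) (M : {set {set T}}).
Hypotheses (e_sym : symmetric e) (e_irr : irreflexive e).
Hypotheses (hM : is_matching e M) (rM : represents e M m).
Implicit Types (x y z b n : T) (c p : seq T).

Let mK : involutive m := rM.1.1.
Local Notation r := (step e m).

(* The edges from [x] to [next c x], for [x] in [F], are the matching edges of
   the cycle; as there are [k] of them, they cover all of [c] but [b]. *)
Lemma blossom_rematched c b : based_blossom e M c b ->
  exists F : {set T},
  [/\ b \notin F /\ prev c b \notin F, forall x, x \in F -> x \in c /\ m x = next c x,
      forall x, x \in F -> next c x \notin F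
    & forall x, x \in c -> x != b -> (x \in F) || (prev c x \in F)].
Proof.
case/andP=> /andP[/and3P[sc uc cc] /eqP sk] /eqP hb.
have hbb v : (v == b) = (v \in c) && ~~ ((m v != v) && (m v \in c)).
  rewrite -in_set1 -hb inE; congr (_ && ~~ _); apply/existsP/andP.
    move=> [w /and3P[wc wv]]; rewrite rM.2 => /andP[_ /eqP ->].
    by rewrite wv wc.
  by move=> [mv mc]; exists (m v); rewrite mc mv rM.2 eqxx eq_sym mv.
pose F := [set x in c | [set x; next c x] \in M].
have FE x : x \in F -> [/\ x \in c, m x = next c x & m x != x].
  rewrite inE rM.2 => /andP[xc /andP[xn /eqP mx]]; split=> //.
  by rewrite mx eq_sym.
have bc : b \in c by have := hbb b; rewrite eqxx => /esym/andP[].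
have bF : b \notin F.
  apply/negP => /FE[_ mb nb]; have := hbb b; rewrite eqxx bc nb mb mem_next bc.
  by [].
have nF x : x \in F -> next c x \notin F.
  move=> xF; have [xc mx _] := FE _ xF; apply/negP => /FE[_ mnx _].
  by have := next_next_neq uc sc xc; rewrite -mnx -mx mK eqxx.
have pbF : prev c b \notin F.
  apply/negP => /FE[pc mp pb]; have := hbb b; rewrite eqxx bc.
  have <- : m (prev c b) = b by rewrite mp next_prev.
  by rewrite mK pc eq_sym pb.
exists F; split=> // [x /FE[]//|x xc xb].
pose G := [set next c x | x in F].
have cG : #|G| = #|F|.
  by apply: card_imset => y z /(congr1 (prev c)); rewrite !prev_next.
have FG : [disjoint F & G].
  rewrite disjoint_subset; apply/subsetP => y yF; rewrite inE.
  by apply/imsetP => -[z zF yz]; have := nF z zF; rewrite -yz yF.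
have kF : #|cycle_edges c :&: M| <= #|F|.
  apply: leq_trans (leq_imset_card (fun y => [set y; next c y]) _).
  apply: subset_leq_card; apply/subsetP => E; rewrite inE => /andP[/imsetP[y yc ->] yM].
  by apply: imset_f; rewrite inE yM yc.
have sub : F :|: G \subset [set y in c] :\ b.
  apply/subsetP => y; rewrite !inE => /orP[yF|/imsetP[z zF ->]].
    have yF' : y \in F by rewrite inE.
    have [-> _ _] := FE _ yF'; rewrite andbT.
    by apply: contraNneq bF => <-.
  have [zc mz nz] := FE _ zF; rewrite mem_next zc andbT.
  by rewrite hbb -mz mK eq_sym nz zc /= andbF.
have cB : #|[set y in c] :\ b| = #|cycle_edges c :&: M|.*2.
  have := cardsD1 b [set y in c]; rewrite inE bc cardsE (card_uniqP uc) sk.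
  by rewrite add1n => -[].
have eFG : F :|: G = [set y in c] :\ b.
  apply/eqP; rewrite eqEcard sub cB cardsU (disjoint_setI0 FG) cards0 subn0 cG addnn.
  by rewrite leq_double.
have : x \in F :|: G by rewrite eFG !inE xb xc.
rewrite inE => /orP[->//|/imsetP[z zF ->]].
by rewrite prev_next // zF orbT.
Qed.

(** Running round the cycle from [b], every other vertex is entered through its matching edge and is
    a node on a walk from [b] to [m b]. The remaining vertices are mates of these, and duality
    applies since it maps walks from [b] to [m b] to such walks. The vertex other than [b] serves to
    have a nontrivial component. *)
Lemma blossom_connect c b : based_blossom e M c b ->
  [/\ exists2 y, y \in c & y != b, connect r b (m b) &
      forall y, y \in c -> y != b -> connect r b y /\ connect r y (m b)].
Proof.
move=> hc; have [F [[bF pbF] FE nF FG]] := blossom_rematched hc.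
case/andP: hc => /andP[/and3P[sc uc cc] _] /eqP hb.
have bc : b \in c by have := set11 b; rewrite -hb inE => /andP[].
have [i d ed] := rot_to bc.
have nE : next (b :: d) =1 next c by move=> y; rewrite -ed next_rot.
have pE : prev (b :: d) =1 prev c by move=> y; rewrite -ed prev_rot.
have cE y : (y \in b :: d) = (y \in c) by rewrite -ed mem_rot.
have ud : uniq (b :: d) by rewrite -ed rot_uniq.
have cd : cycle e (b :: d) by rewrite -ed rot_cycle.
(* The cycle is followed two vertices at a time from a node [x]: the next vertex is the mate of the
   next node. After the last vertex, the closing edge to [b] is an arc to [m b]. *)
have walk s p x : b :: d = p ++ x :: s -> x \notin F ->
    connect r x (m b) /\ (forall z, z \in s -> prev c z \in F -> connect r x z /\ connect r z (m b)).
  have [n] := ubnP (size s); elim: n => // n ih in s p x * => sn es xF.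
  have xd : x \in b :: d by rewrite es mem_cat mem_head orbT.
  have lastE q y : b :: d = rcons q y -> next c y = b.
    move=> eq; have <- : last b d = y by rewrite -(last_cons b) eq last_rcons.
    by rewrite -(prev_first ud) pE next_prev.
  have adjE q y z s' : b :: d = q ++ y :: z :: s' -> next c y = z.
    by move=> eq; rewrite -nE; move: ud; rewrite eq; exact: next_adjacent.
  case: s es sn => [|y s] es sn.
    split=> //; apply: connect1; rewrite /step mK.
    have := next_cycle cd xd; rewrite nE (lastE p) //.
    by rewrite es cats1.
  have ny := adjE _ _ _ _ es.
  have yc : y \in c by rewrite -cE es mem_cat !inE eqxx !orbT.
  have yd : y \in d.
    have -> : d = behead (p ++ x :: y :: s) by rewrite -es.
    by case: (p) => [|a p'] /=; rewrite ?mem_head // mem_cat !inE eqxx !orbT.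
  have yb : y != b by apply: contraTneq yd => ->; case/andP: ud.
  have yF : y \in F by have := FG y yc yb; rewrite -ny prev_next // (negbTE xF) orbF.
  have [_ my] := FE _ yF.
  have es' : b :: d = (p ++ [:: x]) ++ y :: s by rewrite -catA.
  case: s es es' sn => [|z s] es es' sn.
    have yl : next c y = b by apply: (lastE (p ++ [:: x])); rewrite es' cats1.
    by move: pbF; rewrite -yl prev_next // yF.
  have nz := adjE _ _ _ _ es'.
  have zF : z \notin F by rewrite -nz nF.
  have xz : connect r x z.
    apply: connect1; rewrite /step -nz -my mK -ny -nE; exact: next_cycle.
  have [|||h1 h2] := ih s (p ++ [:: x; y]) z => //.
  - by move: sn; rewrite /= ltnS; apply: leq_trans.
  - by rewrite es -catA.
  split; first exact: connect_trans h1.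
  move=> z'; rewrite !inE => /or3P[/eqP ->|/eqP -> _|zs].
  - by rewrite -ny prev_next // (negbTE xF).
  - by split.
  - by case/(h2 _ zs) => h3 h4; split=> //; apply: connect_trans h3.
have [h1 h2] := walk d [::] b erefl bF.
have FGc z : z \in c -> z != b -> prev c z \in F -> connect r b z /\ connect r z (m b).
  move=> zc zb; apply: h2; move: zc; rewrite -cE inE (negbTE zb).
  by [].
split=> // [|y yc yb].
  exists (next c b); rewrite ?mem_next //.
  apply/eqP => nb; have := next_next_neq uc sc bc.
  by rewrite !nb eqxx.
have := FG y yc yb => /orP[yF|]; last exact: FGc.
have [_ my] := FE y yF.
have [c1 c2] : connect r b (m y) /\ connect r (m y) (m b).
  apply: FGc; rewrite my ?mem_next ?prev_next //.
  by apply: contraNneq pbF => <-; rewrite prev_next.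
split.
  by have := connect_dual e_sym mK c2; rewrite !mK.
by have := connect_dual e_sym mK c1; rewrite !mK.
Qed.

(** After the matching edge [E], the vertices at odd distance from [n] are reached by nonmatching
    edges and enter the digraph through their mates; the others are nodes. A nonempty walk of even
    length ends with a matching edge, hence at a saturated vertex. *)
Lemma alternating_connect p n E : E \in M -> path e n p ->
  path (fun E F => (E \in M) (+) (F \in M)) E (walk_edges n p) ->
  let en := if odd (size p) then m (last n p) else last n p in
  [/\ connect r n en,
      forall t, t \in p -> connect r n t /\ connect r t en \/
                           connect r n (m t) /\ connect r (m t) en
    & p != [::] -> ~~ odd (size p) -> m (last n p) != last n p].
Proof.
have [k] := ubnP (size p); elim: k => // k ih in p n E *.
case: p => [|y [|z p]] sp EM /=.
- by move=> _ _; split=> //; exact: connect0.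
- rewrite andbT EM /= => ny /andP[nM _].
  have st : connect r n (m y) by apply: connect1; rewrite /step mK.
  split=> // t; rewrite inE => /eqP ->; right; split=> //; exact: connect0.
- rewrite EM /= => /and3P[ny yz pz] /and3P[nM].
  rewrite (negbTE nM) /= => yzM pp.
  have /andP[nyz /eqP my] : (y != z) && (m y == z) by rewrite -rM.2.
  have st : connect r n z by apply: connect1; rewrite /step -my mK.
  have [|h1 h2 h3] := ih p z [set y; z] _ yzM pz pp.
    by move: sp; rewrite /= ltnS; apply: leq_trans.
  rewrite negbK; split.
  + exact: connect_trans h1.
  + move=> t; rewrite !inE => /or3P[/eqP ->|/eqP ->|/h2].
    * by right; rewrite my.
    * by left.
    * by case=> -[c1 c2]; [left|right]; split=> //; apply: connect_trans c1.
  + move=> _ po; have [p0|p0] := eqVneq p [::]; last exact: h3.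
    by rewrite p0 /= -my mK my.
Qed.

End Blossom.

(** * Strongly connected components and the three sets *)

Section Main.
Variables (T : finType) (e : rel T).
Hypotheses (e_sym : symmetric e) (e_irr : irreflexive e).
Implicit Types (m : T -> T) (M : {set {set T}}) (a b v x y : T) (c p : seq T).

(** The strong component of [a] contains [m a], so it is closed under mates. A saturated [v] is thus
    joined to [m v] and back; an unsaturated one lies on a closed walk because the component has a
    second node. *)
Lemma component_V_T m a a' x v : max_mating e m -> a != a' ->
  connect (step e m) a a' -> connect (step e m) a' a ->
  connect (step e m) a (m a) -> connect (step e m) (m a) a ->
  connect (step e m) a x -> connect (step e m) x a -> v = x \/ v = m x -> v \in V_T e.
Proof.
move=> hm aa' c1 c2 c3 c4 c5 c6 vx; have mK := hm.1.1.
have xm : connect (step e m) x (m x).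
  apply: (connect_trans c6 (connect_trans c3 _)); exact: (connect_dual e_sym mK c6).
have mx : connect (step e m) (m x) x.
  by apply: (connect_trans _ (connect_trans c4 c5)); exact: (connect_dual e_sym mK c5).
have [mv|mv] := eqVneq (m v) v; last first.
  by apply: (connect_mate_V_T e_sym e_irr hm mv); case: vx => ->; rewrite ?mK.
have ev : v = x by case: vx => // vx; rewrite -mv vx mK.
subst x; have [y [yv vy yv']] : exists y, [/\ y != v, connect (step e m) v y
    & connect (step e m) y v].
  have [av|av] := eqVneq a v; last by exists a.
  by exists a'; subst v; rewrite eq_sym.
case/connectP: vy => -[|z q] /= => [_ h|/andP[vz pq] lq]; first by rewrite h eqxx in yv.
apply: (closed_walk_V_T e_sym e_irr hm mv vz).
by apply: connect_trans yv'; apply/connectP; exists q.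
Qed.

(** Everything lies on a closed walk: from [b] round the first blossom to [m b], along the
    connecting walk to [z], round the second blossom to [m z], and back to [b] by the dual of the
    connecting walk. *)
Lemma jposy_V_T M c1 c2 b p v : maximum_matching e M -> jposy e M c1 c2 b p ->
  v \in c1 ++ c2 ++ b :: p -> v \in V_T e.
Proof.
move=> xM /and5P[bl1 bl2 pp op /and3P[al hd _]] hv; have hM := xM.1.
have [m rM] := represented e_sym e_irr hM.
have hm := max_represents e_irr xM rM; have mK := hm.1.1.
have [[y0 y0c y0b] b1 in1] := blossom_connect e_sym rM bl1.
have [_ b2 in2] := blossom_connect e_sym rM bl2.
case: p pp op al hd bl2 b2 in2 hv => // y p /= /andP[_ pp] op al hd bl2 b2 in2 hv.
have /andP[_ /eqP mb] : (b != y) && (m b == y) by rewrite -rM.2.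
have := alternating_connect rM hd pp al; rewrite (negbTE op) => -[w1 win _].
rewrite -mb in w1 win hv bl2 b2 in2.
set z := last (m b) p in w1 win bl2 b2 in2.
have w2 := connect_dual e_sym mK w1; rewrite mK in w2.
have mbb := connect_trans w1 (connect_trans b2 w2).
have [by0 y0b'] := in1 _ y0c y0b.
have concl x : connect (step e m) b x -> connect (step e m) x b -> v = x \/ v = m x -> v \in V_T e.
  apply: (@component_V_T m b y0) => //; first by rewrite eq_sym.
  exact: connect_trans mbb.
have bz := connect_trans b1 w1; have zb := connect_trans b2 w2.
move: hv; rewrite !mem_cat !in_cons => /or3P[vc|vc|].
- have [vb|vb] := eqVneq v b; first by apply: (concl b) => //; left.
  have [h1 h2] := in1 _ vc vb; apply: (concl v) => //; last by left.
  exact: connect_trans mbb.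
- have [vb|vb] := eqVneq v z; first by apply: (concl z) => //; left.
  have [h1 h2] := in2 _ vc vb; apply: (concl v); last by left.
    exact: connect_trans h1.
  exact: connect_trans w2.
- case/or3P=> [/eqP vb|/eqP vb|/win].
  + by apply: (concl b) => //; left.
  + by apply: (concl b) => //; right.
  + case=> -[h1 h2]; [apply: (concl v)|apply: (concl (m v))]; rewrite ?mK;
      try (by left); try (by right).
    * exact: connect_trans h1.
    * exact: connect_trans zb.
    * exact: connect_trans h1.
    * exact: connect_trans zb.
Qed.

(** The unsaturated end is its own mate, so the dual of the walk leads from it back to [b] and plays
    the part of the second blossom. *)
Lemma jflower_V_T M c b p v : maximum_matching e M -> jflower e M c b p ->
  v \in c ++ b :: p -> v \in V_T e.
Proof.
move=> xM /and5P[bl pp ep al un] hv; have hM := xM.1.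
have [m rM] := represented e_sym e_irr hM.
have hm := max_represents e_irr xM rM; have mK := hm.1.1.
have [[y0 y0c y0b] bb in1] := blossom_connect e_sym rM bl.
have [by0 y0b'] := in1 _ y0c y0b.
move: un; rewrite (represented_unsaturated _ hM rM) => /eqP mu.
have [t [tin mbb bt tb]] : exists t : T, [/\
    forall x, x \in p -> exists2 z, x = z \/ x = m z & connect (step e m) b z /\ connect (step e m) z t,
    connect (step e m) (m b) b, connect (step e m) b t & connect (step e m) t b].
  case: p pp ep al mu {hv} => [|y p] /=.
    by move=> _ _ _ mu; exists b; split; rewrite ?mu.
  move=> /andP[by' pp] op al mu.
  have [yM|yM] := boolP ([set b; y] \in M).
    have := alternating_connect rM yM pp al; rewrite negbK in op; rewrite op => -[w1 win _].
    have /andP[_ /eqP mb] : (b != y) && (m b == y) by rewrite -rM.2.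
    rewrite mu in w1 win.
    have w2 := connect_dual e_sym mK w1; rewrite mu -mb mK mb in w2.
    have yb := connect_trans w1 w2.
    rewrite mb in bb.
    exists (last y p); split=> //; last exact: (connect_trans bb w1).
    - move=> x; rewrite inE => /orP[/eqP ->|/win].
        by exists b; [right|split=> //; exact: (connect_trans bb w1)].
      by case=> -[h1 h2]; [exists x|exists (m x)]; rewrite ?mK;
         try (by left); try (by right); split=> //; exact: (connect_trans bb h1).
    - by rewrite mb.
  (* A walk of even length starting with a nonmatching edge would end with a matching edge, against
     the choice of its end. Its second edge serves as the fictitious preceding matching edge. *)
  case: p pp op al mu => // z p pp op al mu.
  have zM : [set y; z] \in M by move: al => /= /andP[]; rewrite (negbTE yM).
  have pb : path e b [:: y, z & p] by rewrite /= by'.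
  have := @alternating_connect _ _ _ _ rM [:: y, z & p] b [set y; z] zM pb.
  case=> [|_ _ /(_ isT op)]; last by rewrite /= -[last z p]/(last y (z :: p)) mu eqxx.
  by move: al; rewrite /alternating /= zM (negbTE yM).
have concl x : connect (step e m) b x -> connect (step e m) x b -> v = x \/ v = m x -> v \in V_T e.
  by apply: (@component_V_T m b y0) => //; [rewrite eq_sym|exact: connect_trans mbb].
have [vb|vb] := eqVneq v b; first by apply: (concl b) => //; left.
move: hv; rewrite mem_cat in_cons (negbTE vb) /= => /orP[vc|/tin[z vz [h1 h2]]].
  have [h1 h2] := in1 _ vc vb; apply: (concl v) => //; last by left.
  exact: connect_trans mbb.
by apply: (concl z) => //; exact: connect_trans tb.
Qed.

End Main.

Theorem theorem7p1 (T : finType) (e : rel T)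
    (e_sym : symmetric e) (e_irr : irreflexive e) :
  V_T e = V_ESG e /\ V_ESG e = V_J e.
Proof.
have s1 : V_T e \subset V_ESG e.
  apply/subsetP => v; rewrite !inE => /asboolP h; apply/asboolP; case: h => [h|]; first by left.
  by case=> M [c1 [c2 [b [p [h1 /andP[h2 _] h3]]]]]; right; exists M, c1, c2, b, p.
have s2 : V_ESG e \subset V_J e.
  apply/subsetP => v; rewrite !inE => /asboolP h; apply/asboolP; case: h.
    case=> M [c [b [p [h1 /and3P[h2 /and5P[h3 _ h4 h5 h6] _] h7]]]]; left.
    by exists M, c, b, p; split=> //; apply/and5P.
  case=> M [c1 [c2 [b [p [h1 /and5P[h2 h3 _ h4 /and3P[_ h5 h6]] h7]]]]]; right.
  by exists M, c1, c2, b, p; split=> //; apply/and5P.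
have s3 : V_J e \subset V_T e.
  apply/subsetP => v; rewrite inE => /asboolP[].
    by case=> M [c [b [p [h1 h2 h3]]]]; exact: (jflower_V_T e_sym e_irr h1 h2 h3).
  by case=> M [c1 [c2 [b [p [h1 h2 h3]]]]]; exact: (jposy_V_T e_sym e_irr h1 h2 h3).
split; apply/eqP; rewrite eqEsubset.
  by rewrite s1 (subset_trans s2 s3).
by rewrite s2 (subset_trans s3 s1).
Qed.
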